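(* Let $f$ satisfy (f1) and suppose $f_0\in(0,+\infty)$ and $f_\infty=0$. Then for every $\lambda\in(\lambda_1/f_0,+\infty)$, problem (MO) has two solutions $u^+$ and $u^-$ such that $u^+$ is positive and strictly concave in $(0,1)$ and $u^-$ is negative and strictly convex in $(0,1)$.
   Context: Let $N\ge 1$ be an integer and $f:\mathbb{R}\to\mathbb{R}$ continuous. For $\lambda\ge 0$, problem (MO) is: find $u\in C^2[0,1]$ with $\left((u'(r))^N\right)'=\lambda^N N r^{N-1} f(-u(r))$ for $0<r<1$ and $u'(0)=u(1)=0$. Condition (f1): $f\in C(\mathbb{R},\mathbb{R})$ and $f(s)s^N>0$ for all $s\neq0$. The quantities $f_0,f_\infty\in[0,+\infty]$ are defined by $f_0^N=\lim_{s\to0} f(s)/s^N$ and $f_\infty^N=\lim_{|s|\to+\infty} f(s)/s^N$ (limits assumed to exist in $[0,+\infty]$). $\lambda_1>0$ denotes the first eigenvalue of $\left((-v')^N\right)'=\lambda^N N r^{N-1}v^N$ in $(0,1)$, $v'(0)=v(1)=0$, i.e. the unique $\lambda>0$ for which this problem has a solution $v\in C^2[0,1]$ positive in $(0,1)$. *)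

(* Defs.v *)
From Stdlib Require Import Reals Lra.
Open Scope R_scope.

(* g' is the derivative of g on the closed interval [0,1]
   (one-sided at the endpoints: difference quotients restricted to [0,1]). *)
Definition has_deriv_01 (g g' : R -> R) : Prop :=
  forall r, 0 <= r <= 1 ->
  forall eps, 0 < eps -> exists delta, 0 < delta /\
    forall y, 0 <= y <= 1 -> y <> r -> Rabs (y - r) < delta ->
      Rabs ((g y - g r) / (y - r) - g' r) < eps.

Definition cont_01 (g : R -> R) : Prop :=
  forall r, 0 <= r <= 1 ->
  forall eps, 0 < eps -> exists delta, 0 < delta /\
    forall y, 0 <= y <= 1 -> Rabs (y - r) < delta -> Rabs (g y - g r) < eps.

Definition C2_01 (u u1 u2 : R -> R) : Prop :=
  has_deriv_01 u u1 /\ has_deriv_01 u1 u2 /\ cont_01 u2.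

Definition MO_sol (N : nat) (f : R -> R) (lam : R) (u : R -> R) : Prop :=
  exists u1 u2, C2_01 u u1 u2 /\
    (forall r, 0 < r < 1 ->
       derivable_pt_lim (fun s => (u1 s) ^ N) r
         (lam ^ N * INR N * r ^ (N - 1) * f (- u r))) /\
    u1 0 = 0 /\ u 1 = 0.

Definition eig_sol (N : nat) (lam : R) (v : R -> R) : Prop :=
  exists v1 v2, C2_01 v v1 v2 /\
    (forall r, 0 < r < 1 ->
       derivable_pt_lim (fun s => (- v1 s) ^ N) r
         (lam ^ N * INR N * r ^ (N - 1) * (v r) ^ N)) /\
    v1 0 = 0 /\ v 1 = 0.

Definition pos_01 (v : R -> R) : Prop := forall r, 0 < r < 1 -> 0 < v r.
Definition neg_01 (v : R -> R) : Prop := forall r, 0 < r < 1 -> v r < 0.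

Definition is_first_eigenvalue (N : nat) (lam1 : R) : Prop :=
  0 < lam1 /\ (exists v, eig_sol N lam1 v /\ pos_01 v) /\
  (forall lam, 0 < lam -> (exists v, eig_sol N lam v /\ pos_01 v) -> lam = lam1).

Definition strictly_concave_01 (u : R -> R) : Prop :=
  forall x y t, 0 < x < 1 -> 0 < y < 1 -> x <> y -> 0 < t < 1 ->
    t * u x + (1 - t) * u y < u (t * x + (1 - t) * y).

Definition strictly_convex_01 (u : R -> R) : Prop :=
  forall x y t, 0 < x < 1 -> 0 < y < 1 -> x <> y -> 0 < t < 1 ->
    u (t * x + (1 - t) * y) < t * u x + (1 - t) * u y.

Definition lim_at_0 (N : nat) (f : R -> R) (L : R) : Prop :=
  forall eps, 0 < eps -> exists delta, 0 < delta /\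
    forall s, s <> 0 -> Rabs s < delta -> Rabs (f s / s ^ N - L) < eps.

Definition lim_at_inf (N : nat) (f : R -> R) (L : R) : Prop :=
  forall eps, 0 < eps -> exists M, 0 < M /\
    forall s, M < Rabs s -> Rabs (f s / s ^ N - L) < eps.

Definition cond_f1 (N : nat) (f : R -> R) : Prop :=
  continuity f /\ forall s, s <> 0 -> 0 < f s * s ^ N.

(* Main.v *)
(** Up to the sign change [u = -v] and the reflection [s |-> (-1)^N f (-s)], both
    solutions come from a positive solution of [((-v')^N)' = lam^N N r^(N-1) g v].
    This is obtained by shooting from [v 0 = a, v' 0 = 0].  As [g] is only
    continuous, the shooting is done on Euler polygons for the pair
    [(v, w = (-v')^N)], which depend continuously on [a]; sublinearity at infinity
    gives [v 1 > 0] for [a = A] large, so for every mesh either some [a] in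
    [[a0, A]] gives [v 1 = 0], or [a = a0] already gives [v 1 >= 0].  Limits along
    an ultrafilter on [nat] turn these polygons into a genuine solution.  The second
    alternative is impossible for small [a0]: there [lam^N g s >= K s^N] with
    [K > lam1^N], and integrating the equation twice upgrades [v >= t phi]
    ([phi] the first eigenfunction) to [v >= sigma t phi] with a fixed [sigma > 1],
    hence, after iteration, [v] would be unbounded. *)

Require Import Defs.
From Stdlib Require Import Reals Lra Lia ZArith Classical ClassicalEpsilon.
From Coquelicot Require Import Coquelicot.
From mathcomp Require filter.
Open Scope R_scope.

(** * Ultrafilter limits *)

(** An ultrafilter finer than [eventually] makes all bounded sequences converge at once. One choice
    of [U] thus serves every point [r], and no subsequences need to be extracted. The ultrafilter of
    mathcomp is translated here into the filter classes of Coquelicot. *)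
Lemma ultrafilter_nat :
  exists U : (nat -> Prop) -> Prop,
    ProperFilter U /\ filter_le U eventually /\
    forall P, U P \/ U (fun n => ~ P n).
Proof.
  destruct (@filter.ultraFilterLemma nat eventually) as [U [HU Hle]].
  - split.
    + intros [n Hn]. exact (Hn n (le_n n)).
    + split.
      * exact (@filter_true _ _ (@filter_filter _ _ eventually_filter)).
      * intros P Q. exact (@filter_and _ _ (@filter_filter _ _ eventually_filter) P Q).
      * intros P Q. exact (@filter_imp _ _ (@filter_filter _ _ eventually_filter) P Q).
  - exists U. destruct (filter.ultra_proper (F := U)) as [Hne HF].
    repeat split.
    + intros P HP. apply NNPP. intros Hn. apply Hne.
      refine (filter.filterS _ HP). intros n Hpn. apply Hn. exists n. exact Hpn.
    + exact filter.filterT.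
    + intros P Q HP HQ. exact (filter.filterI HP HQ).
    + intros P Q HPQ HP. exact (filter.filterS HPQ HP).
    + exact Hle.
    + intros P. exact (filter.in_ultra_setVsetC P HU).
Qed.

(** The limit is the supremum of those [t] that lie below [x n] for [U]-many [n]. The dichotomy of
    [U] turns the failure of a lower bound [t] into the opposite inequality on a set of [U]. *)
Lemma ultrafilter_bounded_lim (U : (nat -> Prop) -> Prop) (PU : ProperFilter U)
  (HU : forall P, U P \/ U (fun n => ~ P n)) (x : nat -> R) (m M : R) :
  (forall n, m <= x n <= M) ->
  exists l, filterlim x U (locally l).
Proof.
  intros Hb.
  destruct (completeness (fun t => U (fun n => t <= x n))) as [l [Hub Hlub]].
  - exists M. intros t Ht. destruct (filter_ex _ Ht) as [n Hn].
    specialize (Hb n). lra.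
  - exists m. apply filter_forall. intros n. apply Hb.
  - exists l. apply filterlim_locally. intros eps.
    assert (Hhi : U (fun n => ~ (l + eps / 2 <= x n))).
    { destruct (HU (fun n => l + eps / 2 <= x n)) as [H|H]; [|exact H].
      specialize (Hub _ H). destruct eps; simpl in *; lra. }
    assert (Hlo : U (fun n => l - eps / 2 <= x n)).
    { destruct (HU (fun n => l - eps / 2 <= x n)) as [H|H]; [exact H|].
      exfalso. assert (l <= l - eps / 2); [|destruct eps; simpl in *; lra].
      apply Hlub. intros t Ht. apply Rnot_lt_le. intros Hlt.
      destruct (filter_ex _ (filter_and _ _ H Ht)) as [n [H1 H2]]. lra. }
    generalize (filter_and _ _ Hhi Hlo). apply filter_imp.
    intros n [H1 H2]. apply Rabs_def1; unfold minus, plus, opp; simpl;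
      destruct eps; simpl in *; lra.
Qed.

(** * The [N]-th root *)

Lemma pow_lt_compat (N : nat) (a b : R) : (1 <= N)%nat -> 0 <= a < b -> a ^ N < b ^ N.
Proof.
  intros HN Hab. induction HN as [|N HN IH]; simpl in *; [lra|].
  assert (0 <= a ^ N) by (apply pow_le; lra). nra.
Qed.

Lemma pow_le_inv (N : nat) (a b : R) : (1 <= N)%nat -> 0 <= b -> a ^ N <= b ^ N -> a <= b.
Proof.
  intros HN Hb H. apply Rnot_lt_le. intros Hlt.
  pose proof (pow_lt_compat N b a HN (conj Hb Hlt)). lra.
Qed.

Lemma pow_superadd (N : nat) (a b : R) :
  (1 <= N)%nat -> 0 <= a -> 0 <= b -> a ^ N + b ^ N <= (a + b) ^ N.
Proof.
  intros HN Ha Hb. induction HN as [|N HN IH]; simpl in *; [lra|].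
  assert (0 <= a ^ N) by (apply pow_le; lra).
  assert (0 <= b ^ N) by (apply pow_le; lra). nra.
Qed.

(** [Rpower] is an exponential and never vanishes, so the value 0 for [x <= 0] is set by hand; this
    makes the root continuous on the whole line. *)
Definition nroot (N : nat) (x : R) : R :=
  if Rlt_dec 0 x then Rpower x (/ INR N) else 0.

Lemma nroot_ge0 (N : nat) (x : R) : 0 <= nroot N x.
Proof.
  unfold nroot. destruct (Rlt_dec 0 x); [|lra]. unfold Rpower. left. apply exp_pos.
Qed.

Lemma nroot_0 (N : nat) : nroot N 0 = 0.
Proof. unfold nroot. destruct (Rlt_dec 0 0); lra. Qed.

Lemma nroot_pow (N : nat) (x : R) : (1 <= N)%nat -> 0 <= x -> nroot N x ^ N = x.
Proof.
  intros HN Hx. unfold nroot. destruct (Rlt_dec 0 x) as [H|H].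
  - rewrite <- Rpower_pow by apply exp_pos. rewrite Rpower_mult, Rinv_l.
    + now apply Rpower_1.
    + apply not_0_INR. lia.
  - replace x with 0 by lra. apply pow_i. lia.
Qed.

Lemma nroot_pow_ge (N : nat) (x : R) : (1 <= N)%nat -> x <= nroot N x ^ N.
Proof.
  intros HN. destruct (Rle_dec 0 x) as [H|H].
  - rewrite nroot_pow; [lra|assumption|assumption].
  - pose proof (pow_le _ N (nroot_ge0 N x)). lra.
Qed.

Lemma nroot_le_of_pow (N : nat) (x y : R) :
  (1 <= N)%nat -> 0 <= y -> x <= y ^ N -> nroot N x <= y.
Proof.
  intros HN Hy H. destruct (Rle_dec 0 x) as [Hx|Hx].
  - apply (pow_le_inv N); trivial. now rewrite nroot_pow.
  - unfold nroot. destruct (Rlt_dec 0 x); lra.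
Qed.

Lemma nroot_le (N : nat) (x y : R) : (1 <= N)%nat -> x <= y -> nroot N x <= nroot N y.
Proof.
  intros HN H. apply nroot_le_of_pow; trivial; [apply nroot_ge0|].
  pose proof (nroot_pow_ge N y HN). lra.
Qed.

Lemma nroot_lt (N : nat) (x y : R) :
  (1 <= N)%nat -> 0 <= x < y -> nroot N x < nroot N y.
Proof.
  intros HN [Hx H]. apply Rnot_le_lt. intros Hle.
  pose proof (pow_incr _ _ N (conj (nroot_ge0 N y) Hle)) as Hp.
  rewrite !nroot_pow in Hp by (trivial; lra). lra.
Qed.

Lemma nroot_of_pow (N : nat) (x : R) : (1 <= N)%nat -> 0 <= x -> nroot N (x ^ N) = x.
Proof.
  intros HN Hx. apply Rle_antisym.
  - apply nroot_le_of_pow; trivial; lra.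
  - apply (pow_le_inv N); trivial; [apply nroot_ge0|]. now apply nroot_pow_ge.
Qed.

(** Superadditivity of the power makes the root subadditive. Used in both orders, this gives the
    modulus of continuity [nroot N (Rabs (x - y))] for the root. *)
Lemma nroot_subadd (N : nat) (x y : R) :
  (1 <= N)%nat -> nroot N x <= nroot N y + nroot N (Rabs (x - y)).
Proof.
  intros HN.
  pose proof (nroot_ge0 N y). pose proof (nroot_ge0 N (Rabs (x - y))).
  apply nroot_le_of_pow; trivial; [lra|].
  eapply Rle_trans; [|apply pow_superadd; trivial].
  pose proof (nroot_pow_ge N y HN). pose proof (nroot_pow_ge N (Rabs (x - y)) HN).
  pose proof (Rle_abs (x - y)). lra.
Qed.

Lemma nroot_continuity (N : nat) : (1 <= N)%nat -> continuity (nroot N).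
Proof.
  intros HN x eps Heps. exists (eps ^ N). split; [now apply pow_lt|].
  intros y [_ Hy]. simpl in *. unfold R_dist in *.
  assert (H : nroot N (Rabs (y - x)) < eps).
  { rewrite <- (nroot_of_pow N eps) by (trivial; lra).
    apply nroot_lt; trivial. split; [apply Rabs_pos|trivial]. }
  pose proof (nroot_subadd N x y HN) as H1. pose proof (nroot_subadd N y x HN) as H2.
  rewrite Rabs_minus_sym in H1. apply Rabs_def1; lra.
Qed.

(** * Euler polygons *)

Section Euler.
Context (N : nat) (B h : R) (G : R -> R).

(* Pairs approximating [v] and [(-v')^N] at the node [k * h]; the
   increments of [r ^ N] integrate [N r^(N-1)] exactly. *)
Fixpoint euler (a : R) (k : nat) : R * R :=
  match k with
  | O => (a, 0)
  | S j => let (v, w) := euler a j in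
           (v - h * nroot N w,
            w + B * ((INR (S j) * h) ^ N - (INR j * h) ^ N) * G v)
  end.

Definition ev (a : R) (k : nat) : R := fst (euler a k).
Definition ew (a : R) (k : nat) : R := snd (euler a k).

Lemma ev_S (a : R) (k : nat) : ev a (S k) = ev a k - h * nroot N (ew a k).
Proof. unfold ev, ew. simpl. now destruct (euler a k). Qed.

Lemma ew_S (a : R) (k : nat) :
  ew a (S k) = ew a k + B * ((INR (S k) * h) ^ N - (INR k * h) ^ N) * G (ev a k).
Proof.
  unfold ev, ew. simpl euler. now destruct (euler a k).
Qed.

(** Each step composes continuous functions, so the polygon depends continuously on its starting
    height, even where the differential equation may lack uniqueness. The intermediate value theorem
    in the shooting rests on this. *)
Lemma euler_continuity (k : nat) :
  (1 <= N)%nat -> continuity G ->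
  continuity (fun a => ev a k) /\ continuity (fun a => ew a k).
Proof.
  intros HN HG. induction k as [|k [IHv IHw]].
  - split; unfold ev, ew; simpl; intros x; [apply derivable_continuous_pt, derivable_pt_id|].
    apply continuity_pt_const. now intros ? ?.
  - split; intros x.
    + apply continuity_pt_ext with (fun a => ev a k - h * nroot N (ew a k)).
      * intros a. now rewrite ev_S.
      * apply continuity_pt_minus; [apply IHv|].
        apply continuity_pt_mult; [apply continuity_pt_const; now intros ? ?|].
        apply (continuity_pt_comp (fun a => ew a k)); [apply IHw|].
        now apply nroot_continuity.
    + apply continuity_pt_ext with
        (fun a => ew a k + B * ((INR (S k) * h) ^ N - (INR k * h) ^ N) * G (ev a k)).
      * intros a. now rewrite ew_S.
      * apply continuity_pt_plus; [apply IHw|].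
        apply continuity_pt_mult; [apply continuity_pt_const; now intros ? ?|].
        apply (continuity_pt_comp (fun a => ev a k)); [apply IHv|]. apply HG.
Qed.

Context (HN : (1 <= N)%nat) (HB : 0 < B) (Hh : 0 < h) (HG : forall s, 0 <= G s).

Lemma euler_weight_ge0 (k : nat) : 0 <= B * ((INR (S k) * h) ^ N - (INR k * h) ^ N).
Proof.
  apply Rmult_le_pos; [lra|].
  assert ((INR k * h) ^ N <= (INR (S k) * h) ^ N); [|lra].
  apply pow_incr. rewrite S_INR. pose proof (pos_INR k). nra.
Qed.

(** The exact increments of [r ^ N] telescope; this is the integrated flux equation with [G]
    replaced by bounds. *)
Lemma ew_increment (a lo hi : R) (k m : nat) :
  (k <= m)%nat -> (forall j, (k <= j < m)%nat -> lo <= G (ev a j) <= hi) ->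
  lo * B * ((INR m * h) ^ N - (INR k * h) ^ N) <= ew a m - ew a k
  <= hi * B * ((INR m * h) ^ N - (INR k * h) ^ N).
Proof.
  intros Hkm Hj. induction Hkm as [|m Hkm IH]; [split; lra|].
  assert (IH' := IH (fun j Hj' => Hj j ltac:(lia))).
  rewrite ew_S. pose proof (euler_weight_ge0 m) as Hw.
  destruct (Hj m ltac:(lia)) as [H1 H2].
  pose proof (Rmult_le_compat_l _ _ _ Hw H1).
  pose proof (Rmult_le_compat_l _ _ _ Hw H2).
  split; lra.
Qed.

Lemma ew_le (a : R) (k m : nat) : (k <= m)%nat -> ew a k <= ew a m.
Proof.
  intros Hkm. induction Hkm as [|m Hkm IH]; [lra|].
  rewrite ew_S. pose proof (Rmult_le_pos _ _ (euler_weight_ge0 m) (HG (ev a m))). lra.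
Qed.

(** Discrete concavity: the flux is nondecreasing, so every step between the nodes [k] and [m] has a
    slope between the two end values. *)
Lemma ev_slope (a : R) (k m : nat) :
  (k <= m)%nat ->
  (INR m * h - INR k * h) * nroot N (ew a k) <= ev a k - ev a m
  <= (INR m * h - INR k * h) * nroot N (ew a m).
Proof.
  intros Hkm. induction Hkm as [|m Hkm IH]; [lra|].
  rewrite ev_S, S_INR.
  pose proof (nroot_le N _ _ HN (ew_le a k m Hkm)) as H1.
  pose proof (nroot_le N _ _ HN (ew_le a m (S m) (le_S _ _ (le_n m)))) as H2.
  assert (0 <= INR m * h - INR k * h).
  { pose proof (le_INR _ _ Hkm). nra. }
  pose proof (Rmult_le_compat_l h _ _ (Rlt_le _ _ Hh) H1).
  pose proof (Rmult_le_compat_l h _ _ (Rlt_le _ _ Hh) H2).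
  pose proof (Rmult_le_compat_l _ _ _ H H2).
  split; nra.
Qed.

Lemma ev_le (a : R) (k m : nat) : (k <= m)%nat -> ev a m <= ev a k.
Proof.
  intros Hkm. destruct (ev_slope a k m Hkm) as [H _].
  pose proof (le_INR _ _ Hkm). pose proof (nroot_ge0 N (ew a k)).
  assert (0 <= (INR m * h - INR k * h) * nroot N (ew a k)) by (apply Rmult_le_pos; nra).
  lra.
Qed.

(** The polygon never rises above its start [a], so a bound for [G] on the half-line below [a]
    controls every increment. *)
Lemma ew_bound (a M : R) (k : nat) :
  (forall s, s <= a -> G s <= M) -> 0 <= ew a k <= M * B * (INR k * h) ^ N.
Proof.
  intros HM. split; [exact (ew_le a 0 k (Nat.le_0_l k))|].
  destruct (ew_increment a 0 M 0 k (Nat.le_0_l k)) as [_ H].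
  - intros j _. split; [apply HG|]. apply HM. apply (ev_le a 0 j). lia.
  - unfold ew at 2 in H. simpl in H. rewrite Rmult_0_l, pow_i in H by lia. lra.
Qed.

Lemma ev_bound (a M : R) (k : nat) :
  (forall s, s <= a -> G s <= M) ->
  a - INR k * h * nroot N (M * B * (INR k * h) ^ N) <= ev a k <= a.
Proof.
  intros HM. split; [|apply (ev_le a 0 k); lia].
  destruct (ev_slope a 0 k (Nat.le_0_l k)) as [_ H].
  unfold ev at 1 in H. simpl in H.
  pose proof (nroot_le N _ _ HN (proj2 (ew_bound a M k HM))) as H1.
  assert (H2 : 0 <= INR k * h) by (pose proof (pos_INR k); nra).
  pose proof (Rmult_le_compat_l _ _ _ H2 H1). nra.
Qed.

End Euler.

(** * Limits of Euler polygons *)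

(** The mesh number [i] has [S i] equal steps, so its node [S i] lies exactly at 1. *)
Definition mesh (i : nat) : R := / INR (S i).

(** Index of the last node not beyond [r], for [r >= 0]: the polygons are sampled as step
    functions. *)
Definition grid_index (r : R) (i : nat) : nat := Z.to_nat (Int_part (r * INR (S i))).

Lemma mesh_pos (i : nat) : 0 < mesh i.
Proof. apply Rinv_0_lt_compat, lt_0_INR. lia. Qed.

Lemma grid_index_spec (r : R) (i : nat) :
  0 <= r -> INR (grid_index r i) * mesh i <= r < INR (grid_index r i) * mesh i + mesh i.
Proof.
  intros Hr. unfold grid_index, mesh.
  assert (Hn : 0 < INR (S i)) by (apply lt_0_INR; lia).
  destruct (base_Int_part (r * INR (S i))) as [H1 H2].
  assert (H0 : (0 <= Int_part (r * INR (S i)))%Z).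
  { assert (-1 < Int_part (r * INR (S i)))%Z; [|lia].
    apply lt_IZR. nra. }
  rewrite INR_IZR_INZ, Z2Nat.id by exact H0.
  set (z := IZR (Int_part _)) in *. clearbody z. clear H0.
  set (n := INR (S i)) in *. clearbody n.
  assert (E : r = r * n * / n) by (field; apply Rgt_not_eq; exact Hn). rewrite E. clear E.
  assert (Hi := Rinv_0_lt_compat _ Hn). split; [apply Rmult_le_compat_r; lra|].
  replace (z * / n + / n) with ((z + 1) * / n) by ring.
  apply Rmult_lt_compat_r; lra.
Qed.

Lemma grid_index_le (s r : R) (i : nat) :
  0 <= s <= r -> (grid_index s i <= grid_index r i)%nat.
Proof.
  intros [Hs Hsr]. apply Nat.nlt_ge. intros Hlt.
  destruct (grid_index_spec s i Hs) as [H _].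
  destruct (grid_index_spec r i ltac:(lra)) as [_ H'].
  apply (le_INR (S _)) in Hlt. rewrite S_INR in Hlt. pose proof (mesh_pos i). nra.
Qed.

Lemma grid_index_INR (k i : nat) : grid_index (INR k * mesh i) i = k.
Proof.
  assert (H0 : 0 <= INR k * mesh i).
  { pose proof (pos_INR k). pose proof (mesh_pos i). nra. }
  destruct (grid_index_spec _ i H0) as [H1 H2]. pose proof (mesh_pos i).
  assert (INR (grid_index (INR k * mesh i) i) <= INR k) by nra.
  assert (INR k < INR (S (grid_index (INR k * mesh i) i))) by (rewrite S_INR; nra).
  apply INR_le in H3. apply INR_lt in H4. lia.
Qed.

(** * Limits of real sequences along a filter *)

Section FilterLimits.
Context (U : (nat -> Prop) -> Prop) (PU : ProperFilter U).

Lemma filterlim_R_near (x : nat -> R) (l d : R) :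
  filterlim x U (locally l) -> 0 < d -> U (fun n => Rabs (x n - l) < d).
Proof.
  intros Hx Hd. exact (proj1 (filterlim_locally (F := U) x l) Hx (mkposreal d Hd)).
Qed.

Lemma filterlim_R_le (x y : nat -> R) (l m : R) :
  U (fun n => x n <= y n) -> filterlim x U (locally l) -> filterlim y U (locally m) ->
  l <= m.
Proof.
  intros Hxy Hx Hy. exact (filterlim_le (F := U) x y (Finite l) (Finite m) Hxy Hx Hy).
Qed.

Lemma filterlim_R_minus (x y : nat -> R) (l m : R) :
  filterlim x U (locally l) -> filterlim y U (locally m) ->
  filterlim (fun n => x n - y n) U (locally (l - m)).
Proof.
  intros Hx Hy. apply (filterlim_comp_2 (G := locally l) (H := locally (- m)) x (fun n => - y n) Rplus);
    [exact Hx| |].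
  - apply (filterlim_comp _ _ _ y Ropp U (locally m)); [exact Hy|].
    exact (filterlim_opp (V := R_NormedModule) m).
  - exact (filterlim_plus (V := R_NormedModule) l (- m)).
Qed.

Lemma filterlim_R_mult (x y : nat -> R) (l m : R) :
  filterlim x U (locally l) -> filterlim y U (locally m) ->
  filterlim (fun n => x n * y n) U (locally (l * m)).
Proof.
  intros Hx Hy. apply (filterlim_comp_2 (G := locally l) (H := locally m) x y Rmult Hx Hy).
  exact (filterlim_mult (K := R_AbsRing) l m).
Qed.

Lemma filterlim_R_continuity (x : nat -> R) (f : R -> R) (l : R) :
  continuity f -> filterlim x U (locally l) -> filterlim (fun n => f (x n)) U (locally (f l)).
Proof.
  intros Hf Hx. apply (filterlim_comp _ _ _ x f U (locally l)); [exact Hx|].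
  apply continuity_pt_filterlim, Hf.
Qed.

Lemma filterlim_grid (r : R) :
  filter_le U eventually -> 0 <= r ->
  filterlim (fun i => INR (grid_index r i) * mesh i) U (locally r).
Proof.
  intros HU Hr. apply (filterlim_filter_le_1 _ HU).
  apply filterlim_locally. intros eps.
  destruct (archimed_cor1 eps (cond_pos eps)) as [n [Hn Hn0]].
  exists n. intros i Hi.
  destruct (grid_index_spec r i Hr) as [H1 H2].
  assert (mesh i <= / INR n).
  { apply Rinv_le_contravar; [apply lt_0_INR; lia|]. apply le_INR. lia. }
  apply Rabs_def1; unfold minus, plus, opp; simpl; lra.
Qed.

End FilterLimits.

Lemma euler_limit (N : nat) (B A M a0 : R) (G : R -> R) (a : nat -> R) :
  (1 <= N)%nat -> 0 < B -> (forall s, 0 <= G s) ->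
  (forall s, s <= A -> G s <= M) ->
  (forall i, a0 <= a i <= A) ->
  (forall i, 0 <= ev N B (mesh i) G (a i) (S i)) ->
  (forall i, ev N B (mesh i) G (a i) (S i) * (a i - a0) = 0) ->
  exists v w : R -> R,
    w 0 = 0 /\ a0 <= v 0 /\ 0 <= v 1 /\ v 1 * (v 0 - a0) = 0 /\
    (forall s r, 0 <= s <= r ->
       (r - s) * nroot N (w s) <= v s - v r <= (r - s) * nroot N (w r)) /\
    (forall s r lo hi d, 0 <= s <= r -> 0 < d ->
       (forall x, v r - d <= x <= v s + d -> lo <= G x <= hi) ->
       lo * B * (r ^ N - s ^ N) <= w r - w s <= hi * B * (r ^ N - s ^ N)).
Proof.
  intros HN HB HG HM Ha H1 Hprod.
  destruct ultrafilter_nat as [U [PU [HUev HU]]].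
  set (V := fun r i => ev N B (mesh i) G (a i) (grid_index r i)).
  set (W := fun r i => ew N B (mesh i) G (a i) (grid_index r i)).
  assert (HMi : forall i s, s <= a i -> G s <= M).
  { intros i s Hs. apply HM. specialize (Ha i). lra. }
  assert (HM0 : 0 <= M) by (apply Rle_trans with (G A); [apply HG|apply HM; lra]).
  (* [HWb] and, below, [HVb] are uniform in [i], as the existence of limits along [U] requires. *)
  assert (HWb : forall r i, 0 <= r -> 0 <= W r i <= M * B * r ^ N).
  { intros r i Hr.
    destruct (ew_bound N B (mesh i) G HN HB (mesh_pos i) HG (a i) M (grid_index r i) (HMi i))
      as [Hl Hu].
    split; [exact Hl|]. eapply Rle_trans; [exact Hu|].
    apply Rmult_le_compat_l; [apply Rmult_le_pos; lra|].
    apply pow_incr. split; [|apply grid_index_spec; lra].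
    apply Rmult_le_pos; [apply pos_INR|left; apply mesh_pos]. }
  assert (Hslope : forall s r i, 0 <= s <= r ->
    (INR (grid_index r i) * mesh i - INR (grid_index s i) * mesh i) * nroot N (W s i)
      <= V s i - V r i
    <= (INR (grid_index r i) * mesh i - INR (grid_index s i) * mesh i) * nroot N (W r i)).
  { intros s r i Hsr. apply ev_slope; trivial; [apply mesh_pos|now apply grid_index_le]. }
  assert (Hidx0 : forall i, grid_index 0 i = O).
  { intros i. replace 0 with (INR 0 * mesh i) by (simpl; ring). apply grid_index_INR. }
  assert (Hidx1 : forall i, grid_index 1 i = S i).
  { intros i. rewrite <- (grid_index_INR (S i) i). f_equal. unfold mesh.
    field. apply not_0_INR. lia. }
  assert (HV0 : forall i, V 0 i = a i) by (intros i; unfold V; now rewrite Hidx0).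
  assert (HVb : forall r i, 0 <= r -> a0 - r * nroot N (M * B * r ^ N) <= V r i <= A).
  { intros r i Hr. destruct (Hslope 0 r i ltac:(lra)) as [_ Hs].
    rewrite HV0, Hidx0 in Hs. simpl in Hs. specialize (Ha i).
    destruct (grid_index_spec r i Hr) as [Hg _].
    pose proof (nroot_le N _ _ HN (proj2 (HWb r i Hr))) as Hw.
    assert (Hg0 : 0 <= INR (grid_index r i) * mesh i)
      by (apply Rmult_le_pos; [apply pos_INR|left; apply mesh_pos]).
    pose proof (Rmult_le_compat _ _ _ _ Hg0 (nroot_ge0 N (W r i)) Hg Hw).
    split; [lra|].
    pose proof (ev_le N B (mesh i) G HN HB (mesh_pos i) HG (a i) 0 (grid_index r i)
                  (Nat.le_0_l _)) as Hle.
    change (V r i <= a i) in Hle. lra. }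
  (* The condition [0 <= r] stands under the existential, so that choice yields functions on all of
     [R]; the pair [(0, 0)] is a dummy value for negative [r]. *)
  assert (Hlim : forall r, exists p : R * R, 0 <= r ->
            filterlim (V r) U (locally (fst p)) /\ filterlim (W r) U (locally (snd p))).
  { intros r. destruct (Rle_dec 0 r) as [Hr|Hr]; [|exists (0, 0); intros; lra].
    destruct (ultrafilter_bounded_lim U PU HU (V r) _ _ (fun i => HVb r i Hr)) as [l Hl].
    destruct (ultrafilter_bounded_lim U PU HU (W r) _ _ (fun i => HWb r i Hr)) as [m Hm].
    exists (l, m). now intros _. }
  set (p := fun r => proj1_sig (constructive_indefinite_description _ (Hlim r))).
  assert (Hp : forall r, 0 <= r ->
            filterlim (V r) U (locally (fst (p r))) /\ filterlim (W r) U (locally (snd (p r))))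
    by (intros r; exact (proj2_sig (constructive_indefinite_description _ (Hlim r)))).
  clearbody p.
  set (v := fun r => fst (p r) : R). set (w := fun r => snd (p r) : R).
  assert (Hv : forall r, 0 <= r -> filterlim (V r) U (locally (v r))) by (intros; now apply Hp).
  assert (Hw : forall r, 0 <= r -> filterlim (W r) U (locally (w r))) by (intros; now apply Hp).
  assert (Hconst : forall c : R, filterlim (fun _ : nat => c) U (locally c))
    by (intros c; apply filterlim_const).
  assert (Hall : forall P : nat -> Prop, (forall n, P n) -> U P)
    by (intros P HP; now apply filter_forall).
  assert (Hlim_eq : forall (x y : nat -> R) (l m : R), (forall n : nat, x n = y n) ->
             filterlim x U (locally l) -> filterlim y U (locally m) -> l = m).
  { intros x y l m Hxy Hx Hy. apply Rle_antisym;
    [apply (filterlim_R_le U PU x y)|apply (filterlim_R_le U PU y x)]; trivial;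
    apply Hall; intros n; rewrite Hxy; lra. }
  (* For [U]-many [i] the samples at [s] and [r] are within [d] of their limits; monotonicity of the
     polygon then confines all values in between to the interval where [G] is bounded. *)
  assert (Hinc : forall s r lo hi d, 0 <= s <= r -> 0 < d ->
       (forall x, v r - d <= x <= v s + d -> lo <= G x <= hi) ->
       U (fun i => lo * B * ((INR (grid_index r i) * mesh i) ^ N
                             - (INR (grid_index s i) * mesh i) ^ N) <= W r i - W s i
                   <= hi * B * ((INR (grid_index r i) * mesh i) ^ N
                             - (INR (grid_index s i) * mesh i) ^ N))).
  { intros s r lo hi d Hsr Hd Hx.
    pose proof (filterlim_R_near U PU _ _ d (Hv s ltac:(lra)) Hd) as Hvs.
    pose proof (filterlim_R_near U PU _ _ d (Hv r ltac:(lra)) Hd) as Hvr.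
    generalize (filter_and _ _ Hvs Hvr). apply filter_imp. intros i [Hs Hr].
    apply Rabs_def2 in Hs. apply Rabs_def2 in Hr.
    apply ew_increment; trivial; [apply mesh_pos|now apply grid_index_le|].
    intros j Hj. apply Hx.
    pose proof (ev_le N B (mesh i) G HN HB (mesh_pos i) HG (a i) _ _ (proj1 Hj)) as Hj1.
    assert (Hjr : (j <= grid_index r i)%nat) by lia.
    pose proof (ev_le N B (mesh i) G HN HB (mesh_pos i) HG (a i) _ _ Hjr) as Hj2.
    change (ev N B (mesh i) G (a i) j <= V s i) in Hj1.
    change (V r i <= ev N B (mesh i) G (a i) j) in Hj2. lra. }
  assert (Hinclim : forall s r c, 0 <= s <= r ->
     filterlim (fun i => c * B * ((INR (grid_index r i) * mesh i) ^ N
                             - (INR (grid_index s i) * mesh i) ^ N)) U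
        (locally (c * B * (r ^ N - s ^ N)))).
  { intros s r c Hsr. apply filterlim_R_mult; [trivial|apply Hconst|].
    apply filterlim_R_minus; [trivial| |];
      apply (filterlim_R_continuity U _ (fun x => x ^ N));
      solve [intros x; apply derivable_continuous_pt, derivable_pt_pow
            |apply filterlim_grid; trivial; lra]. }
  exists v, w. split; [|split; [|split; [|split; [|split]]]].
  - apply (Hlim_eq (W 0) (fun _ => 0)); [|apply Hw; lra|apply Hconst].
    intros i. unfold W. now rewrite Hidx0.
  - apply (filterlim_R_le U PU (fun _ => a0) (V 0)); [|apply Hconst|apply Hv; lra].
    apply Hall. intros i. rewrite HV0. apply Ha.
  - apply (filterlim_R_le U PU (fun _ => 0) (V 1)); [|apply Hconst|apply Hv; lra].
    apply Hall. intros i. unfold V. rewrite Hidx1. apply H1.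
  - apply (Hlim_eq (fun i => V 1 i * (V 0 i - a0)) (fun _ => 0)); [| |apply Hconst].
    + intros i. rewrite HV0. unfold V. rewrite Hidx1. apply Hprod.
    + apply filterlim_R_mult; [trivial|apply Hv; lra|].
      apply filterlim_R_minus; [trivial|apply Hv; lra|apply Hconst].
  - intros s r H. split.
    + eapply (filterlim_R_le U PU);
        [apply Hall; intros i; exact (proj1 (Hslope s r i H))| |].
      * apply filterlim_R_mult; [trivial| |].
        -- apply filterlim_R_minus; [trivial| |]; apply filterlim_grid; trivial; lra.
        -- apply filterlim_R_continuity; [now apply nroot_continuity|apply Hw; lra].
      * apply filterlim_R_minus; [trivial| |]; apply Hv; lra.
    + eapply (filterlim_R_le U PU);
        [apply Hall; intros i; exact (proj2 (Hslope s r i H))| |].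
      * apply filterlim_R_minus; [trivial| |]; apply Hv; lra.
      * apply filterlim_R_mult; [trivial| |].
        -- apply filterlim_R_minus; [trivial| |]; apply filterlim_grid; trivial; lra.
        -- apply filterlim_R_continuity; [now apply nroot_continuity|apply Hw; lra].
  - intros s r lo hi d Hsr Hd Hx. specialize (Hinc s r lo hi d Hsr Hd Hx). split.
    + refine (filterlim_R_le U PU _ _ _ _
                (filter_imp (F := U) _ _ (fun i Hi => proj1 Hi) Hinc) _ _).
      * now apply Hinclim.
      * apply filterlim_R_minus; [trivial| |]; apply Hw; lra.
    + refine (filterlim_R_le U PU _ _ _ _
                (filter_imp (F := U) _ _ (fun i Hi => proj2 Hi) Hinc) _ _).
      * apply filterlim_R_minus; [trivial| |]; apply Hw; lra.
      * now apply Hinclim.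
Qed.

(** * Regularity of the limit *)

Lemma nroot_derivable_pt_lim (N : nat) (x : R) :
  (1 <= N)%nat -> 0 < x ->
  derivable_pt_lim (nroot N) x (/ (INR N * nroot N x ^ (N - 1))).
Proof.
  intros HN Hx.
  assert (HN0 : INR N <> 0) by (apply not_0_INR; lia).
  apply is_derive_Reals.
  apply is_derive_ext_loc with (fun t => Rpower t (/ INR N)).
  - exists (mkposreal x Hx). intros t Ht. apply Rabs_def2 in Ht.
    unfold minus, plus, opp in Ht; simpl in Ht.
    unfold nroot. destruct (Rlt_dec 0 t); [trivial|lra].
  - apply is_derive_Reals.
    replace (/ (INR N * nroot N x ^ (N - 1))) with (/ INR N * Rpower x (/ INR N - 1)).
    + now apply derivable_pt_lim_power.
    + unfold nroot. destruct (Rlt_dec 0 x); [|lra].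
      rewrite <- Rpower_pow by apply exp_pos. rewrite Rpower_mult, minus_INR by lia.
      replace (/ INR N - 1) with (- (/ INR N * (INR N - INR 1))) by (simpl; field; trivial).
      rewrite Rpower_Ropp, Rinv_mult. reflexivity.
Qed.

Lemma has_deriv_pt_lim (g : R -> R) (r l eps : R) :
  derivable_pt_lim g r l -> 0 < eps ->
  exists delta, 0 < delta /\
    forall y, y <> r -> Rabs (y - r) < delta -> Rabs ((g y - g r) / (y - r) - l) < eps.
Proof.
  intros Hg Heps. destruct (Hg eps Heps) as [[d Hd] H]. exists d. split; [trivial|].
  intros y Hy Hyr. specialize (H (y - r)).
  replace (r + (y - r)) with y in H by ring. apply H; [lra|trivial].
Qed.

Lemma has_deriv_01_opp (g g' : R -> R) :
  has_deriv_01 g g' -> has_deriv_01 (fun r => - g r) (fun r => - g' r).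
Proof.
  intros Hg r Hr eps Heps. destruct (Hg r Hr eps Heps) as [d [Hd H]].
  exists d. split; [trivial|]. intros y Hy Hne Hyd. rewrite <- Rabs_Ropp.
  replace (- ((- g y - - g r) / (y - r) - - g' r)) with ((g y - g r) / (y - r) - g' r)
    by (field; lra).
  now apply H.
Qed.

Lemma continuity_cont_01 (g g' : R -> R) :
  continuity g -> (forall r, 0 <= r <= 1 -> g r = g' r) -> cont_01 g'.
Proof.
  intros Hg Heq r Hr eps Heps. destruct (Hg r eps Heps) as [d [Hd H]].
  exists d. split; [trivial|]. intros y Hy Hyr. rewrite <- !Heq by trivial.
  destruct (Req_dec r y) as [->|Hne].
  - unfold Rminus. rewrite Rplus_opp_r, Rabs_R0. trivial.
  - apply H. split; [split; [exact I|trivial]|exact Hyr].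
Qed.

(** * Continuity and first derivatives of the solution and its flux *)

Section IntegralSolution.
Context (N : nat) (B : R) (G v w : R -> R).
Context (HN : (1 <= N)%nat) (HB : 0 < B) (HGc : continuity G) (HG0 : forall s, 0 <= G s).
Context (Hw0 : w 0 = 0).
Context (Hslope : forall s r, 0 <= s <= r ->
  (r - s) * nroot N (w s) <= v s - v r <= (r - s) * nroot N (w r)).
Context (Hinc : forall s r lo hi d, 0 <= s <= r -> 0 < d ->
  (forall x, v r - d <= x <= v s + d -> lo <= G x <= hi) ->
  lo * B * (r ^ N - s ^ N) <= w r - w s <= hi * B * (r ^ N - s ^ N)).

Lemma sol_antitone (s r : R) : 0 <= s <= r -> v r <= v s.
Proof.
  intros Hsr. destruct (Hslope s r Hsr) as [H _].
  pose proof (nroot_ge0 N (w s)).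
  assert (0 <= (r - s) * nroot N (w s)) by (apply Rmult_le_pos; lra). lra.
Qed.

Lemma flux_le (s r : R) : 0 <= s <= r -> w s <= w r.
Proof.
  intros Hsr.
  (* Only the lower bound 0 matters, but [Hinc] also asks for an upper one: the maximum of [G] on
     the interval with margin 1. *)
  destruct (continuity_ab_maj G (v r - 1) (v s + 1)) as [m [Hm _]].
  - pose proof (sol_antitone s r Hsr). lra.
  - intros c _. apply HGc.
  - destruct (Hinc s r 0 (G m) 1 Hsr Rlt_0_1) as [H _]; [|lra].
    intros x Hx. split; [apply HG0|now apply Hm].
Qed.

Lemma flux_ge0 (r : R) : 0 <= r -> 0 <= w r.
Proof. intros Hr. rewrite <- Hw0. apply flux_le. lra. Qed.

(** The hypotheses concern [r >= 0] only; the even extension gives a function continuous on the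
    whole line. Within distance 1 of [r] the slope is at most the root of the flux at
    [Rabs r + 1]. *)
Lemma sol_continuity : continuity (fun r => v (Rabs r)).
Proof.
  intros r eps Heps.
  set (L := nroot N (w (Rabs r + 1))).
  assert (HL : 0 <= L) by apply nroot_ge0.
  assert (Hd : 0 < eps / (L + 1)) by (apply Rdiv_lt_0_compat; lra).
  exists (Rmin 1 (eps / (L + 1))). split; [apply Rmin_pos; lra|].
  intros y [_ Hy]. simpl in *. unfold R_dist in *.
  pose proof (Rabs_triang_inv2 y r) as Hyr.
  pose proof (Rmin_l 1 (eps / (L + 1))). pose proof (Rmin_r 1 (eps / (L + 1))).
  pose proof (Rabs_pos y) as Hy0. pose proof (Rabs_pos r) as Hr0.
  set (y' := Rabs y) in *. set (r' := Rabs r) in *.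
  assert (Hyr1 : Rabs (y' - r') < 1) by lra.
  assert (Hyr2 : Rabs (y' - r') < eps / (L + 1)) by lra.
  apply Rabs_def2 in Hyr1.
  assert (Hlip : Rabs (v y' - v r') <= Rabs (y' - r') * L).
  { destruct (Rle_dec r' y') as [H1|H1].
    - destruct (Hslope r' y' (conj Hr0 H1)) as [_ H2].
      pose proof (sol_antitone r' y' (conj Hr0 H1)).
      rewrite Rabs_left1, Rabs_right by lra.
      assert (nroot N (w y') <= L) by (apply nroot_le; trivial; apply flux_le; lra).
      nra.
    - assert (H1' : y' <= r') by lra.
      destruct (Hslope y' r' (conj Hy0 H1')) as [_ H2].
      pose proof (sol_antitone y' r' (conj Hy0 H1')).
      rewrite Rabs_right, Rabs_left1 by lra.
      assert (nroot N (w r') <= L) by (apply nroot_le; trivial; apply flux_le; lra).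
      nra. }
  eapply Rle_lt_trans; [exact Hlip|].
  apply Rle_lt_trans with (eps / (L + 1) * L).
  - apply Rmult_le_compat_r; lra.
  - replace eps with (eps / (L + 1) * (L + 1)) at 2 by (field; lra).
    apply Rmult_lt_compat_l; lra.
Qed.

(** In the variable [r ^ N] the flux has derivative [B * G (v r)]. Stated this way the estimate also
    holds at the origin, where it is later divided by [y ^ N]. *)
Lemma flux_increment (r eps : R) :
  0 <= r -> 0 < eps ->
  exists delta, 0 < delta /\ forall y, 0 <= y -> Rabs (y - r) < delta ->
    Rabs (w y - w r - G (v r) * B * (y ^ N - r ^ N)) <= eps * B * Rabs (y ^ N - r ^ N).
Proof.
  intros Hr Heps.
  destruct (HGc (v r) eps Heps) as [eta [Heta HGeta]].
  assert (HGx : forall x, Rabs (x - v r) < eta -> G (v r) - eps <= G x <= G (v r) + eps).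
  { intros x Hx. destruct (Req_dec (v r) x) as [<-|Hne]; [lra|].
    specialize (HGeta x (conj (conj I Hne) Hx)). simpl in HGeta. unfold R_dist in HGeta.
    apply Rabs_def2 in HGeta. lra. }
  assert (Heta2 : 0 < eta / 2) by lra.
  destruct (sol_continuity r (eta / 2) Heta2) as [d [Hd Hvd]].
  exists d. split; [exact Hd|]. intros y Hy Hyr.
  assert (Hv : Rabs (v y - v r) < eta / 2).
  { destruct (Req_dec r y) as [<-|Hne].
    - unfold Rminus. rewrite Rplus_opp_r, Rabs_R0. lra.
    - specialize (Hvd y (conj (conj I Hne) Hyr)). simpl in Hvd. unfold R_dist in Hvd.
      now rewrite (Rabs_pos_eq y), (Rabs_pos_eq r) in Hvd. }
  apply Rabs_def2 in Hv.
  (* The margin [eta / 4] added to the deviation [eta / 2] of [v] stays below [eta]. *)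
  assert (Hd4 : 0 < eta / 4) by lra.
  destruct (Rle_dec r y) as [H|H].
  - destruct (Hinc r y (G (v r) - eps) (G (v r) + eps) (eta / 4) (conj Hr H) Hd4) as [H1 H2].
    { intros x Hx. apply HGx. apply Rabs_def1; lra. }
    assert (r ^ N <= y ^ N) by (apply pow_incr; lra).
    rewrite (Rabs_pos_eq (y ^ N - r ^ N)) by lra. apply Rabs_le. lra.
  - assert (H' : y <= r) by lra.
    destruct (Hinc y r (G (v r) - eps) (G (v r) + eps) (eta / 4) (conj Hy H') Hd4) as [H1 H2].
    { intros x Hx. apply HGx. apply Rabs_def1; lra. }
    assert (y ^ N <= r ^ N) by (apply pow_incr; lra).
    rewrite (Rabs_left1 (y ^ N - r ^ N)) by lra. apply Rabs_le. lra.
Qed.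

Lemma flux_continuity : continuity (fun r => w (Rabs r)).
Proof.
  intros r eps Heps.
  destruct (flux_increment (Rabs r) 1 (Rabs_pos r) Rlt_0_1) as [d1 [Hd1 H1]].
  set (c := (G (v (Rabs r)) + 1) * B).
  assert (Hc : 0 < c) by (apply Rmult_lt_0_compat; [specialize (HG0 (v (Rabs r))); lra|trivial]).
  assert (Hpow : continuity (fun x => Rabs x ^ N)).
  { intros x. apply (continuity_pt_comp Rabs (fun t => t ^ N)).
    - apply Rcontinuity_abs.
    - apply derivable_continuous_pt, derivable_pt_pow. }
  destruct (Hpow r (eps / c) (Rdiv_lt_0_compat _ _ Heps Hc)) as [d2 [Hd2 H2]].
  exists (Rmin d1 d2). split; [now apply Rmin_pos|].
  intros y [Hxy Hy]. simpl in *. unfold R_dist in *.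
  pose proof (Rmin_l d1 d2). pose proof (Rmin_r d1 d2).
  pose proof (Rabs_triang_inv2 y r) as Hyr.
  specialize (H1 (Rabs y) (Rabs_pos y) ltac:(lra)).
  assert (Hy2 : Rabs (y - r) < d2) by lra. specialize (H2 y (conj Hxy Hy2)).
  set (p := Rabs y ^ N - Rabs r ^ N) in *.
  set (W := w (Rabs y) - w (Rabs r)) in *.
  assert (HW : Rabs W <= c * Rabs p).
  { replace W with ((W - G (v (Rabs r)) * B * p) + G (v (Rabs r)) * B * p) by ring.
    eapply Rle_trans; [apply Rabs_triang|].
    rewrite !Rabs_mult, (Rabs_pos_eq (G _)), (Rabs_pos_eq B) by (trivial; lra).
    unfold c. lra. }
  eapply Rle_lt_trans; [exact HW|].
  replace eps with (c * (eps / c)) by (field; lra).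
  now apply Rmult_lt_compat_l.
Qed.

Lemma flux_derivable (r : R) :
  0 < r -> derivable_pt_lim w r (B * INR N * r ^ (N - 1) * G (v r)).
Proof.
  intros Hr eps Heps.
  set (D := INR N * r ^ (N - 1)). set (g := G (v r)).
  assert (HD : 0 <= D) by (apply Rmult_le_pos; [apply pos_INR|apply pow_le; lra]).
  assert (Hg : 0 <= g) by apply HG0.
  (* Chain rule through [r ^ N]: [e1] controls the flux increment and [e2] the difference quotient
     [q] of the power, each costing at most [eps / 2]. The cap [e2 <= 1] gives [Rabs q <= D + 1]. *)
  set (e1 := eps / (2 * B * (D + 1))). set (e2 := Rmin 1 (eps / (2 * B * (g + 1)))).
  assert (He1 : 0 < e1) by (apply Rdiv_lt_0_compat; [lra|apply Rmult_lt_0_compat; nra]).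
  assert (He2 : 0 < e2)
    by (apply Rmin_pos; [lra|apply Rdiv_lt_0_compat; [lra|apply Rmult_lt_0_compat; nra]]).
  destruct (flux_increment r e1 (Rlt_le _ _ Hr) He1) as [d1 [Hd1 H1]].
  assert (Hp := derivable_pt_lim_pow r N). replace (pred N) with (N - 1)%nat in Hp by lia.
  destruct (Hp e2 He2) as [[d2 Hd2] H2]. simpl in H2.
  assert (Hd : 0 < Rmin r (Rmin d1 d2)) by (repeat apply Rmin_pos; trivial).
  exists (mkposreal _ Hd). simpl. intros h Hh0 Hh.
  pose proof (Rmin_l r (Rmin d1 d2)). pose proof (Rmin_r r (Rmin d1 d2)).
  pose proof (Rmin_l d1 d2). pose proof (Rmin_r d1 d2).
  assert (Hhr := Rabs_def2 h r ltac:(lra)).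
  specialize (H1 (r + h) ltac:(lra)). replace (r + h - r) with h in H1 by ring.
  specialize (H1 ltac:(lra)). specialize (H2 h Hh0 ltac:(lra)).
  fold D in H2. fold g in H1.
  set (q := ((r + h) ^ N - r ^ N) / h) in *.
  assert (Eq : (r + h) ^ N - r ^ N = q * h) by (unfold q; field; trivial).
  rewrite Eq in H1.
  assert (Hq : Rabs q <= D + 1).
  { replace q with ((q - D) + D) by ring. eapply Rle_trans; [apply Rabs_triang|].
    rewrite (Rabs_pos_eq D) by trivial. pose proof (Rmin_l 1 (eps / (2 * B * (g + 1)))).
    fold e2 in H5. lra. }
  assert (H1' : Rabs ((w (r + h) - w r) / h - g * B * q) <= e1 * B * Rabs q).
  { replace ((w (r + h) - w r) / h - g * B * q)
      with ((w (r + h) - w r - g * B * (q * h)) * / h) by (field; trivial).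
    rewrite Rabs_mult, Rabs_inv.
    assert (Hh' : 0 < Rabs h) by now apply Rabs_pos_lt.
    apply Rmult_le_reg_r with (Rabs h); [trivial|].
    rewrite Rmult_assoc, Rinv_l, Rmult_1_r by lra.
    rewrite (Rabs_mult q h) in H1. lra. }
  replace (B * INR N * r ^ (N - 1) * g) with (g * B * D) by (unfold D; ring).
  replace ((w (r + h) - w r) / h - g * B * D)
    with (((w (r + h) - w r) / h - g * B * q) + g * B * (q - D)) by ring.
  eapply Rle_lt_trans; [apply Rabs_triang|].
  rewrite !Rabs_mult, (Rabs_pos_eq g), (Rabs_pos_eq B) by lra.
  assert (E1 : e1 * B * (D + 1) = eps / 2) by (unfold e1; field; lra).
  assert (E2 : e2 * B * (g + 1) <= eps / 2).
  { replace (eps / 2) with (eps / (2 * B * (g + 1)) * (B * (g + 1))) by (field; lra).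
    rewrite Rmult_assoc. apply Rmult_le_compat_r; [apply Rmult_le_pos; lra|].
    apply Rmin_r. }
  assert (e1 * B * Rabs q <= eps / 2).
  { rewrite <- E1. apply Rmult_le_compat_l; [apply Rmult_le_pos; lra|trivial]. }
  assert (g * B * Rabs (q - D) < eps / 2); [|lra].
  apply Rle_lt_trans with (g * B * e2).
  - apply Rmult_le_compat_l; [apply Rmult_le_pos; lra|lra].
  - assert (0 < e2 * B) by now apply Rmult_lt_0_compat. lra.
Qed.

Lemma root_flux_continuity : continuity (fun r => nroot N (w (Rabs r))).
Proof.
  intros r. apply (continuity_pt_comp (fun r => w (Rabs r)) (nroot N)).
  - apply flux_continuity.
  - now apply nroot_continuity.
Qed.

(** The slope bounds squeeze the difference quotient between the values of the continuous function
    [- nroot N (w r)] at the two ends. *)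
Lemma sol_has_deriv : has_deriv_01 v (fun r => - nroot N (w r)).
Proof.
  intros r Hr eps Heps.
  destruct (root_flux_continuity r eps Heps) as [d [Hd H]].
  exists d. split; [exact Hd|]. intros y Hy Hne Hyr.
  specialize (H y (conj (conj I (not_eq_sym Hne)) Hyr)). simpl in H. unfold R_dist in H.
  rewrite (Rabs_pos_eq y), (Rabs_pos_eq r) in H by lra. apply Rabs_def2 in H.
  destruct (Rlt_dec r y) as [Hlt|Hlt].
  - destruct (Hslope r y ltac:(lra)) as [H1 H2].
    assert (- nroot N (w y) <= (v y - v r) / (y - r) <= - nroot N (w r)).
    { split; [apply Rle_div_r|apply Rle_div_l]; lra. }
    apply Rabs_def1; lra.
  - destruct (Hslope y r ltac:(lra)) as [H1 H2].
    replace ((v y - v r) / (y - r)) with ((v r - v y) / (r - y)) by (field; lra).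
    assert (- nroot N (w r) <= (v r - v y) / (r - y) <= - nroot N (w y)).
    { split; [apply Rle_div_r|apply Rle_div_l]; lra. }
    apply Rabs_def1; lra.
Qed.

(** * Behaviour at the origin and the second derivative *)

Context (HGv0 : 0 < G (v 0)).

(** Near the origin the flux exceeds a positive multiple of [y ^ N], because [G (v 0) > 0];
    monotonicity carries this to every [r > 0]. *)
Lemma flux_pos (r : R) : 0 < r -> 0 < w r.
Proof.
  intros Hr.
  destruct (flux_increment 0 (G (v 0) / 2) (Rle_refl 0) ltac:(lra)) as [d [Hd H]].
  set (y := Rmin r (d / 2)).
  assert (Hy : 0 < y) by (apply Rmin_pos; lra).
  assert (Hyr : y <= r) by apply Rmin_l. assert (Hyd : y <= d / 2) by apply Rmin_r.
  specialize (H y ltac:(lra)). rewrite Rminus_0_r, Rabs_pos_eq in H by lra.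
  specialize (H ltac:(lra)). rewrite Hw0, pow_i, !Rminus_0_r in H by lia.
  assert (Hp : 0 < y ^ N) by now apply pow_lt.
  rewrite (Rabs_pos_eq (y ^ N)) in H by lra.
  assert (H' := Rabs_def2 (w y - G (v 0) * B * y ^ N) (G (v 0) * B * y ^ N)).
  assert (0 < G (v 0) * B * y ^ N) by (repeat apply Rmult_lt_0_compat; trivial).
  destruct H' as [_ H']; [lra|].
  pose proof (flux_le y r ltac:(lra)). lra.
Qed.

(* [w r / r ^ N], whose limit at the origin makes [v] twice differentiable there. *)
Definition mean_flux (r : R) : R :=
  if Req_dec_T r 0 then B * G (v 0) else w (Rabs r) / Rabs r ^ N.

Lemma mean_flux_pos (r : R) : 0 < mean_flux r.
Proof.
  unfold mean_flux. destruct (Req_dec_T r 0) as [H|H]; [now apply Rmult_lt_0_compat|].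
  apply Rdiv_lt_0_compat; [apply flux_pos|apply pow_lt]; now apply Rabs_pos_lt.
Qed.

Lemma mean_flux_continuity : continuity mean_flux.
Proof.
  intros r. destruct (Req_dec_T r 0) as [->|Hr].
  - intros eps Heps.
    assert (He : 0 < eps / (2 * B)) by (apply Rdiv_lt_0_compat; lra).
    destruct (flux_increment 0 _ (Rle_refl 0) He) as [d [Hd H]].
    exists d. split; [exact Hd|]. intros y [[_ Hy0] Hy]. simpl in *. unfold R_dist in *.
    unfold mean_flux. destruct (Req_dec_T y 0) as [E|_]; [now symmetry in E|].
    destruct (Req_dec_T 0 0) as [_|E]; [|now contradiction E].
    rewrite Rminus_0_r in Hy.
    specialize (H (Rabs y) (Rabs_pos y)). rewrite Rminus_0_r, Rabs_Rabsolu in H.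
    specialize (H Hy). rewrite Hw0, pow_i, !Rminus_0_r in H by lia.
    assert (Hp : 0 < Rabs y ^ N) by (apply pow_lt, Rabs_pos_lt; now apply not_eq_sym).
    set (p := Rabs y ^ N) in *. rewrite (Rabs_pos_eq p) in H by lra.
    replace (w (Rabs y) / p - B * G (v 0)) with ((w (Rabs y) - G (v 0) * B * p) * / p)
      by (field; lra).
    rewrite Rabs_mult, Rabs_inv, (Rabs_pos_eq p) by lra.
    apply Rle_lt_trans with (eps / 2); [|lra].
    apply Rmult_le_reg_r with p; [trivial|]. rewrite Rmult_assoc, Rinv_l, Rmult_1_r by lra.
    replace (eps / 2 * p) with (eps / (2 * B) * B * p) by (field; lra). exact H.
  - apply (continuity_pt_ext_loc (fun t => w (Rabs t) / Rabs t ^ N)).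
    + exists (mkposreal _ (Rabs_pos_lt r Hr)). intros t Ht.
      unfold mean_flux. destruct (Req_dec_T t 0) as [->|_]; [exfalso|trivial].
      unfold ball in Ht; simpl in Ht; unfold AbsRing_ball, abs, minus, plus, opp in Ht.
      simpl in Ht. rewrite Rplus_0_l, Rabs_Ropp in Ht. lra.
    + apply continuity_pt_div.
      * apply flux_continuity.
      * apply (continuity_pt_comp Rabs (fun t => t ^ N)); [apply Rcontinuity_abs|].
        apply derivable_continuous_pt, derivable_pt_pow.
      * apply pow_nonzero. now apply Rabs_no_R0.
Qed.

(** The root is not differentiable at 0 for [N > 1], and the flux vanishes at the origin. Splitting
    off the factor [r] leaves the root of a positive continuous function. *)
Lemma root_flux_mean (r : R) : 0 <= r -> nroot N (w r) = r * nroot N (mean_flux r).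
Proof.
  intros Hr. pose proof (mean_flux_pos r) as Hm.
  rewrite <- (nroot_of_pow N (r * nroot N (mean_flux r))); trivial.
  - f_equal. rewrite Rpow_mult_distr, nroot_pow by (trivial; lra).
    unfold mean_flux. destruct (Req_dec_T r 0) as [->|H0].
    + rewrite Hw0, pow_i by lia. ring.
    + rewrite Rabs_pos_eq by trivial. field. now apply pow_nonzero.
  - apply Rmult_le_pos; [trivial|apply nroot_ge0].
Qed.

(** This is [-v'']: expand [((-v')^N)' = B N r^(N-1) G(v)], divide by [N r^(N-1)], and write [-v'/r]
    as the root of [mean_flux]. *)
Definition sol_second (r : R) : R :=
  B * G (v (Rabs r)) / nroot N (mean_flux r) ^ (N - 1).

Lemma root_mean_flux_pos (r : R) : 0 < nroot N (mean_flux r).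
Proof.
  rewrite <- (nroot_0 N). apply nroot_lt; trivial. pose proof (mean_flux_pos r). lra.
Qed.

Lemma sol_second_continuity : continuity sol_second.
Proof.
  intros r. apply continuity_pt_div.
  - apply continuity_pt_mult; [apply continuity_pt_const; now intros ? ?|].
    apply (continuity_pt_comp (fun r => v (Rabs r)) G); [apply sol_continuity|apply HGc].
  - apply (continuity_pt_comp (fun r => nroot N (mean_flux r)) (fun t => t ^ (N - 1))).
    + apply (continuity_pt_comp mean_flux (nroot N)); [apply mean_flux_continuity|].
      now apply nroot_continuity.
    + apply derivable_continuous_pt, derivable_pt_pow.
  - apply pow_nonzero. pose proof (root_mean_flux_pos r). lra.
Qed.

Lemma root_flux_has_deriv : has_deriv_01 (fun r => nroot N (w r)) sol_second.
Proof.
  intros r Hr eps Heps. destruct (Req_dec_T r 0) as [->|Hr0].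
  (* At 0 the difference quotient is the root [p] of [mean_flux], and [p ^ N = B * G (v 0)] there,
     so dividing by [p ^ (N - 1)] gives back [p]. *)
  - assert (E : sol_second 0 = nroot N (mean_flux 0)).
    { unfold sol_second.
      assert (HP := nroot_pow N (mean_flux 0) HN (Rlt_le _ _ (mean_flux_pos 0))).
      pose proof (root_mean_flux_pos 0) as Hp.
      replace (B * G (v (Rabs 0))) with (nroot N (mean_flux 0) ^ N).
      - destruct N as [|n]; [lia|]. simpl. rewrite Nat.sub_0_r. field.
        apply pow_nonzero. lra.
      - rewrite HP. unfold mean_flux. destruct (Req_dec_T 0 0); [|lra].
        now rewrite Rabs_R0. }
    assert (Hc : continuity (fun r => nroot N (mean_flux r))).
    { intros r. apply (continuity_pt_comp mean_flux (nroot N)); [apply mean_flux_continuity|].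
      now apply nroot_continuity. }
    destruct (Hc 0 eps Heps) as [d [Hd H]]. exists d. split; [exact Hd|].
    intros y Hy Hne Hyd. specialize (H y (conj (conj I (not_eq_sym Hne)) Hyd)).
    simpl in H. unfold R_dist in H.
    rewrite E, Hw0, nroot_0, root_flux_mean, !Rminus_0_r by lra.
    replace (y * nroot N (mean_flux y) / y) with (nroot N (mean_flux y)) by (field; trivial).
    exact H.
  - destruct (has_deriv_pt_lim (fun r => nroot N (w r)) r (sol_second r) eps) as [d [Hd H]];
      trivial.
    + assert (Hpos : 0 < r) by lra.
      assert (HD := derivable_pt_lim_comp w (nroot N) r _ _ (flux_derivable r Hpos)
                      (nroot_derivable_pt_lim N (w r) HN (flux_pos r Hpos))).
      unfold comp in HD.
      replace (sol_second r) with
        (/ (INR N * nroot N (w r) ^ (N - 1)) * (B * INR N * r ^ (N - 1) * G (v r))).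
      * exact HD.
      * unfold sol_second. rewrite root_flux_mean, Rpow_mult_distr, Rabs_pos_eq by lra.
        field. repeat split.
        -- apply pow_nonzero. pose proof (root_mean_flux_pos r). lra.
        -- now apply pow_nonzero.
        -- apply not_0_INR. lia.
    + exists d. split; [trivial|]. intros y _. apply H.
Qed.

Lemma sol_C2 : C2_01 v (fun r => - nroot N (w r)) (fun r => - sol_second r).
Proof.
  split; [exact sol_has_deriv|split].
  - apply has_deriv_01_opp, root_flux_has_deriv.
  - apply continuity_cont_01 with (fun r => - sol_second r); [|trivial].
    intros r. apply continuity_pt_opp. apply sol_second_continuity.
Qed.

Lemma root_flux_pow_derivable (r : R) :
  0 < r ->
  derivable_pt_lim (fun s => nroot N (w s) ^ N) r (B * INR N * r ^ (N - 1) * G (v r)).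
Proof.
  intros Hr. apply is_derive_Reals. apply is_derive_ext_loc with w.
  - exists (mkposreal r Hr). intros t Ht. apply Rabs_def2 in Ht.
    unfold minus, plus, opp in Ht; simpl in Ht. symmetry. apply nroot_pow; trivial.
    apply flux_ge0. lra.
  - apply is_derive_Reals. now apply flux_derivable.
Qed.

End IntegralSolution.

(** * Comparison with the first eigenfunction *)

(** Composing with this projection onto [[0,1]] turns continuity on the closed interval into
    continuity on [R], to which the standard theorems apply. *)
Definition clamp (r : R) : R := Rmax 0 (Rmin 1 r).

Lemma clamp_range (r : R) : 0 <= clamp r <= 1.
Proof.
  unfold clamp. split; [apply Rmax_l|]. apply Rmax_lub; [lra|apply Rmin_l].
Qed.

Lemma clamp_id (r : R) : 0 <= r <= 1 -> clamp r = r.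
Proof. intros Hr. unfold clamp. rewrite Rmin_right, Rmax_right; lra. Qed.

Lemma clamp_dist (x y : R) : Rabs (clamp x - clamp y) <= Rabs (x - y).
Proof.
  unfold clamp, Rmax, Rmin.
  repeat destruct (Rle_dec _ _); unfold Rabs; repeat destruct (Rcase_abs _); lra.
Qed.

Lemma cont_01_clamp (g : R -> R) : cont_01 g <-> continuity (fun r => g (clamp r)).
Proof.
  split.
  - intros Hg r eps Heps.
    destruct (Hg (clamp r) (clamp_range r) eps Heps) as [d [Hd H]].
    exists d. split; [trivial|]. intros y [_ Hy]. simpl in *. unfold R_dist in *.
    apply H; [apply clamp_range|]. pose proof (clamp_dist y r). lra.
  - intros Hg. apply (continuity_cont_01 _ _ Hg). intros r Hr. now rewrite clamp_id.
Qed.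

Lemma has_deriv_01_cont (g g' : R -> R) : has_deriv_01 g g' -> cont_01 g.
Proof.
  intros Hg r Hr eps Heps. destruct (Hg r Hr 1 Rlt_0_1) as [d [Hd H]].
  set (c := Rabs (g' r) + 1).
  assert (Hc : 0 < c) by (pose proof (Rabs_pos (g' r)); unfold c; lra).
  exists (Rmin d (eps / c)). split; [apply Rmin_pos; [trivial|now apply Rdiv_lt_0_compat]|].
  intros y Hy Hyr. pose proof (Rmin_l d (eps / c)). pose proof (Rmin_r d (eps / c)).
  destruct (Req_dec y r) as [->|Hne].
  - unfold Rminus. now rewrite Rplus_opp_r, Rabs_R0.
  - specialize (H y Hy Hne ltac:(lra)).
    set (q := (g y - g r) / (y - r)) in *.
    assert (Hq : Rabs q <= c).
    { replace q with ((q - g' r) + g' r) by ring.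
      eapply Rle_trans; [apply Rabs_triang|]. unfold c. lra. }
    replace (g y - g r) with (q * (y - r)) by (unfold q; field; lra).
    rewrite Rabs_mult. apply Rle_lt_trans with (c * Rabs (y - r)).
    + apply Rmult_le_compat_r; [apply Rabs_pos|trivial].
    + replace eps with (c * (eps / c)) by (field; lra).
      apply Rmult_lt_compat_l; lra.
Qed.

Lemma has_deriv_01_derivable (g g' : R -> R) (r : R) :
  has_deriv_01 g g' -> 0 < r < 1 -> derivable_pt_lim g r (g' r).
Proof.
  intros Hg Hr eps Heps. destruct (Hg r ltac:(lra) eps Heps) as [d [Hd H]].
  assert (Hd' : 0 < Rmin d (Rmin r (1 - r))) by (repeat apply Rmin_pos; lra).
  exists (mkposreal _ Hd'). simpl. intros h Hh0 Hh.
  pose proof (Rmin_l d (Rmin r (1 - r))). pose proof (Rmin_r d (Rmin r (1 - r))).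
  pose proof (Rmin_l r (1 - r)). pose proof (Rmin_r r (1 - r)).
  assert (Hh' := Rabs_def2 h (Rmin r (1 - r)) ltac:(lra)).
  specialize (H (r + h) ltac:(lra) ltac:(lra)).
  replace (r + h - r) with h in H by ring. apply H. lra.
Qed.

(** The classical theorem is applied to [F] composed with [clamp], which is the identity near each
    interior point. *)
Lemma MVT_01 (F F' : R -> R) (x y : R) :
  cont_01 F -> (forall r, 0 < r < 1 -> derivable_pt_lim F r (F' r)) ->
  0 <= x < y -> y <= 1 -> exists c, x < c < y /\ F y - F x = F' c * (y - x).
Proof.
  intros HF HD Hxy Hy.
  assert (HDc : forall c, x < c < y -> derivable_pt_lim (fun r => F (clamp r)) c (F' c)).
  { intros c Hc. apply is_derive_Reals. apply is_derive_ext_loc with F.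
    - assert (Hd : 0 < Rmin c (1 - c)) by (apply Rmin_pos; lra).
      exists (mkposreal _ Hd). intros t Ht.
      pose proof (Rmin_l c (1 - c)). pose proof (Rmin_r c (1 - c)).
      apply Rabs_def2 in Ht. unfold minus, plus, opp in Ht; simpl in Ht.
      rewrite clamp_id; [trivial|lra].
    - apply is_derive_Reals, HD. lra. }
  destruct (MVT (fun r => F (clamp r)) (fun r => r) x y
              (fun c Hc => exist _ (F' c) (HDc c Hc)) (fun c _ => derivable_pt_id c))
    as [c [Hc E]].
  - lra.
  - intros c _. now apply cont_01_clamp.
  - intros c _. apply derivable_continuous_pt, derivable_pt_id.
  - exists c. split; [exact Hc|]. rewrite derive_pt_id in E. simpl in E.
    rewrite !clamp_id in E by lra. lra.
Qed.

Lemma nondecreasing_01 (F F' : R -> R) (x y : R) :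
  cont_01 F -> (forall r, 0 < r < 1 -> derivable_pt_lim F r (F' r)) ->
  (forall r, 0 < r < 1 -> 0 <= F' r) -> 0 <= x <= y -> y <= 1 -> F x <= F y.
Proof.
  intros HF HD Hpos Hxy Hy. destruct (Req_dec x y) as [->|Hne]; [lra|].
  destruct (MVT_01 F F' x y HF HD ltac:(lra) Hy) as [c [Hc E]].
  specialize (Hpos c ltac:(lra)). nra.
Qed.

Lemma cont_01_sub_scal (f g : R -> R) (c : R) :
  cont_01 f -> cont_01 g -> cont_01 (fun r => f r - c * g r).
Proof.
  rewrite !cont_01_clamp. intros Hf Hg r.
  apply (continuity_pt_minus (fun r => f (clamp r)) (fun r => c * g (clamp r))); [apply Hf|].
  apply (continuity_pt_scal (fun r => g (clamp r))), Hg.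
Qed.

Lemma cont_01_comp (f g : R -> R) :
  continuity f -> cont_01 g -> cont_01 (fun r => f (g r)).
Proof.
  rewrite !cont_01_clamp. intros Hf Hg r.
  apply (continuity_pt_comp (fun r => g (clamp r)) f); [apply Hg|apply Hf].
Qed.

Lemma derivable_pt_lim_sub_scal (f g : R -> R) (c r lf lg : R) :
  derivable_pt_lim f r lf -> derivable_pt_lim g r lg ->
  derivable_pt_lim (fun s => f s - c * g s) r (lf - c * lg).
Proof.
  intros Hf Hg. apply (derivable_pt_lim_minus f (fun s => c * g s)); [trivial|].
  now apply derivable_pt_lim_scal.
Qed.

Lemma neg_pow_continuity (N : nat) : continuity (fun x => (- x) ^ N).
Proof.
  intros x. apply (continuity_pt_comp Ropp (fun t => t ^ N)).
  - apply continuity_pt_opp, derivable_continuous_pt, derivable_pt_id.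
  - apply derivable_continuous_pt, derivable_pt_pow.
Qed.

(** * Growth of a supersolution relative to the first eigenfunction *)

Section EigenComparison.
Context (N : nat) (lam1 K : R) (phi v Y w w' : R -> R).
Context (HN : (1 <= N)%nat) (Hlam1 : 0 < lam1) (HK : lam1 ^ N < K).
Context (Hphi : eig_sol N lam1 phi) (Hphipos : pos_01 phi).
Context (Hv : has_deriv_01 v (fun r => - Y r)) (HY : forall r, 0 <= Y r).
Context (Hw : cont_01 w) (Hw0 : w 0 = 0).
Context (HwY : forall r, 0 <= r <= 1 -> w r = Y r ^ N).
Context (Hw' : forall r, 0 < r < 1 -> derivable_pt_lim w r (w' r)).
Context (Hsuper : forall r, 0 < r < 1 -> K * INR N * r ^ (N - 1) * v r ^ N <= w' r).
Context (Hv1 : 0 <= v 1).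

Lemma eig_weight_ge0 (r c : R) : 0 <= r -> 0 <= c -> 0 <= INR N * r ^ (N - 1) * c.
Proof.
  intros Hr Hc. apply Rmult_le_pos; [|trivial].
  apply Rmult_le_pos; [apply pos_INR|now apply pow_le].
Qed.

(** The power [(- p1 r) ^ N] is nondecreasing, so the slope is bounded by its size at 1, where [phi]
    vanishes. *)
Lemma eig_sol_linear_bound : exists C, 0 < C /\ forall r, 0 <= r <= 1 -> phi r <= C * (1 - r).
Proof.
  destruct Hphi as [p1 [p2 [[Hp [Hp1 _]] [HP [Hp10 Hphi1]]]]].
  set (C := Rabs (p1 1) + 1). assert (HC : 0 < C) by (pose proof (Rabs_pos (p1 1)); unfold C; lra).
  assert (HP1 : cont_01 (fun r => (- p1 r) ^ N)).
  { apply (cont_01_comp (fun x => (- x) ^ N)); [apply neg_pow_continuity|].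
    exact (has_deriv_01_cont _ _ Hp1). }
  assert (Hbound : forall r, 0 <= r <= 1 -> - p1 r <= C).
  { intros r Hr. apply Rle_trans with (Rabs (- p1 1)).
    - apply (pow_le_inv N); [trivial|apply Rabs_pos|].
      eapply Rle_trans; [|apply pow_Rabs].
      apply (nondecreasing_01 _ _ r 1 HP1 HP); try lra.
      intros s Hs. rewrite !Rmult_assoc. apply Rmult_le_pos; [apply pow_le; lra|].
      rewrite <- Rmult_assoc. apply eig_weight_ge0; [lra|]. apply pow_le.
      left. now apply Hphipos.
    - rewrite Rabs_Ropp. unfold C. lra. }
  exists C. split; [trivial|]. intros r Hr.
  destruct (Req_dec r 1) as [->|Hne]; [rewrite Hphi1; lra|].
  destruct (MVT_01 phi p1 r 1) as [c [Hc E]]; try lra.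
  - exact (has_deriv_01_cont _ _ Hp).
  - intros s Hs. now apply has_deriv_01_derivable.
  - specialize (Hbound c ltac:(lra)). rewrite Hphi1 in E. nra.
Qed.

(* Integrating the two equations gains the fixed factor [sigma > 1]. *)
Lemma eig_bound_improves (sigma t : R) :
  0 <= sigma -> sigma ^ N * lam1 ^ N = K -> 0 <= t ->
  (forall r, 0 <= r <= 1 -> t * phi r <= v r) ->
  forall r, 0 <= r <= 1 -> sigma * t * phi r <= v r.
Proof.
  intros Hs HsK Ht Hle.
  destruct Hphi as [p1 [p2 [[Hp [Hp1 _]] [HP [Hp10 Hphi1]]]]].
  assert (HP1 : cont_01 (fun r => (- p1 r) ^ N)).
  { apply (cont_01_comp (fun x => (- x) ^ N)); [apply neg_pow_continuity|].
    exact (has_deriv_01_cont _ _ Hp1). }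
  (* First integration, from 0. The difference of the fluxes is nondecreasing, since the choice of
     [sigma] turns the eigenvalue term into [K * (t * phi) ^ N], up to the weight, and
     [t * phi <= v]. *)
  assert (Hflux : forall r, 0 <= r <= 1 -> (sigma * t) ^ N * (- p1 r) ^ N <= w r).
  { intros r Hr.
    assert (H : w 0 - (sigma * t) ^ N * (- p1 0) ^ N <= w r - (sigma * t) ^ N * (- p1 r) ^ N).
    { refine (nondecreasing_01 (fun r => w r - (sigma * t) ^ N * (- p1 r) ^ N)
        (fun r => w' r - (sigma * t) ^ N * (lam1 ^ N * INR N * r ^ (N - 1) * phi r ^ N))
        0 r _ _ _ _ _); try lra.
      - now apply cont_01_sub_scal.
      - intros x Hx. apply derivable_pt_lim_sub_scal; [now apply Hw'|now apply HP].
      - intros x Hx. specialize (Hsuper x Hx).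
        assert (Hx' : (t * phi x) ^ N <= v x ^ N).
        { apply pow_incr. split; [|apply Hle; lra].
          apply Rmult_le_pos; [trivial|left; now apply Hphipos]. }
        assert (HK0 : 0 <= K).
        { rewrite <- HsK. apply Rmult_le_pos; apply pow_le; lra. }
        pose proof (Rmult_le_pos K _ HK0
          (eig_weight_ge0 x (v x ^ N - (t * phi x) ^ N) ltac:(lra) ltac:(lra))) as Hd.
        replace ((sigma * t) ^ N * (lam1 ^ N * INR N * x ^ (N - 1) * phi x ^ N))
          with (K * INR N * x ^ (N - 1) * (t * phi x) ^ N)
          by (rewrite <- HsK, !Rpow_mult_distr; ring).
        lra. }
    rewrite Hw0, Hp10, Ropp_0, pow_i in H by lia. lra. }
  assert (Hslope : forall r, 0 <= r <= 1 -> sigma * t * - p1 r <= Y r).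
  { intros r Hr. apply (pow_le_inv N); trivial.
    rewrite Rpow_mult_distr, <- HwY by trivial. now apply Hflux. }
  intros r Hr.
  (* Second integration, from [r] to 1, where [phi 1 = 0 <= v 1]. *)
  assert (H : sigma * t * phi r - 1 * v r <= sigma * t * phi 1 - 1 * v 1).
  { refine (nondecreasing_01 (fun r => sigma * t * phi r - 1 * v r)
      (fun r => sigma * t * p1 r - 1 * - Y r) r 1 _ _ _ _ _); try lra.
    - apply cont_01_sub_scal; [|exact (has_deriv_01_cont _ _ Hv)].
      apply (cont_01_comp (fun x => sigma * t * x)); [|exact (has_deriv_01_cont _ _ Hp)].
      intros x. apply continuity_pt_scal, derivable_continuous_pt, derivable_pt_id.
    - intros x Hx. apply derivable_pt_lim_sub_scal.
      + apply derivable_pt_lim_scal. now apply has_deriv_01_derivable.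
      + now apply (has_deriv_01_derivable v (fun r => - Y r)).
    - intros x Hx. specialize (Hslope x ltac:(lra)). lra. }
  rewrite Hphi1 in H. lra.
Qed.

(** The linear bounds on [v] and [phi] give the starting ratio [t0 / C]. Each improvement multiplies
    it by [sigma], the root of [K / lam1 ^ N], and the growth is contradicted at the point
    [1 / 2]. *)
Lemma no_positive_supersolution (t0 : R) :
  0 < t0 -> (forall r, 0 <= r <= 1 -> t0 * (1 - r) <= v r) -> False.
Proof.
  intros Ht0 Hlin.
  destruct eig_sol_linear_bound as [C [HC HphiC]].
  assert (Hl : 0 < lam1 ^ N) by now apply pow_lt.
  set (sigma := nroot N (K / lam1 ^ N)).
  assert (HKl : 1 < K / lam1 ^ N) by (apply Rlt_div_r; lra).
  assert (HsK : sigma ^ N * lam1 ^ N = K).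
  { unfold sigma. rewrite nroot_pow by (trivial; lra). field. lra. }
  assert (Hs : 1 < sigma).
  { rewrite <- (nroot_of_pow N 1) by (trivial; lra). rewrite pow1.
    apply nroot_lt; trivial; lra. }
  assert (Hiter : forall n r, 0 <= r <= 1 -> sigma ^ n * (t0 / C) * phi r <= v r).
  { induction n as [|n IH]; intros r Hr.
    - apply Rle_trans with (t0 / C * (C * (1 - r))).
      + simpl. rewrite Rmult_1_l. apply Rmult_le_compat_l; [|now apply HphiC].
        left. now apply Rdiv_lt_0_compat.
      + replace (t0 / C * (C * (1 - r))) with (t0 * (1 - r)) by (field; lra). now apply Hlin.
    - simpl. rewrite (Rmult_assoc sigma). apply eig_bound_improves; trivial; [lra|].
      apply Rmult_le_pos; [apply pow_le; lra|left; now apply Rdiv_lt_0_compat]. }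
  assert (Hc : 0 < t0 / C * phi (1 / 2)).
  { apply Rmult_lt_0_compat; [now apply Rdiv_lt_0_compat|apply Hphipos; lra]. }
  set (c := t0 / C * phi (1 / 2)) in *.
  (* With this bound [sigma ^ n * c] is at least [Rabs (v (1 / 2)) + c], which exceeds
     [v (1 / 2)]. *)
  destruct (Pow_x_infinity sigma) with (b := Rabs (v (1 / 2)) / c + 1) as [n Hn].
  { rewrite Rabs_pos_eq; lra. }
  specialize (Hn n (le_n n)). rewrite Rabs_pos_eq in Hn by (apply pow_le; lra).
  specialize (Hiter n (1 / 2) ltac:(lra)).
  rewrite Rmult_assoc in Hiter. fold c in Hiter.
  pose proof (Rle_abs (v (1 / 2))).
  assert (H1 : (Rabs (v (1 / 2)) / c + 1) * c <= sigma ^ n * c)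
    by (apply Rmult_le_compat_r; lra).
  replace ((Rabs (v (1 / 2)) / c + 1) * c) with (Rabs (v (1 / 2)) + c) in H1 by (field; lra).
  lra.
Qed.

End EigenComparison.

(** * Shooting *)

(** A concave function lies above its chord: the drop on [[0,r]] and the drop on [[r,1]] are
    compared through the common slope [Y r]. *)
Lemma slope_linear_lower (v Y : R -> R) :
  (forall s r, 0 <= s <= r -> (r - s) * Y s <= v s - v r <= (r - s) * Y r) ->
  0 <= v 1 -> forall r, 0 <= r <= 1 -> v 0 * (1 - r) <= v r.
Proof.
  intros Hslope Hv1 r Hr.
  destruct (Hslope 0 r ltac:(lra)) as [_ H1]. destruct (Hslope r 1 ltac:(lra)) as [H2 _].
  nra.
Qed.

Lemma slope_strictly_concave (v Y : R -> R) :
  (forall s r, 0 <= s <= r -> (r - s) * Y s <= v s - v r <= (r - s) * Y r) ->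
  (forall s r, 0 <= s < r -> r < 1 -> Y s < Y r) ->
  strictly_concave_01 v.
Proof.
  intros Hslope HY.
  assert (Hlt : forall x y t, 0 < x -> x < y -> y < 1 -> 0 < t < 1 ->
            t * v x + (1 - t) * v y < v (t * x + (1 - t) * y)).
  { intros x y t Hx Hxy Hy Ht. set (z := t * x + (1 - t) * y).
    assert (Hz1 : z - x = (1 - t) * (y - x)) by (unfold z; ring).
    assert (Hz2 : y - z = t * (y - x)) by (unfold z; ring).
    assert (Hxz : x < z) by nra. assert (Hzy : z < y) by nra.
    (* The slope bounds are not strict; cutting [[z,y]] at an inner point [m] with [Y z < Y m] makes
       the drop strictly larger than [(y - z) * Y z]. *)
    set (m := (z + y) / 2).
    destruct (Hslope x z ltac:(lra)) as [_ H1].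
    destruct (Hslope z m ltac:(unfold m; lra)) as [H2 _].
    destruct (Hslope m y ltac:(unfold m; lra)) as [H3 _].
    pose proof (HY z m ltac:(unfold m; lra) ltac:(unfold m; lra)) as H4.
    assert (H5 : (y - m) * Y z < (y - m) * Y m)
      by (apply Rmult_lt_compat_l; [unfold m|]; lra).
    assert (H6 : (y - z) * Y z < v z - v y) by lra.
    rewrite Hz1 in H1. rewrite Hz2 in H6.
    pose proof (Rmult_le_compat_l t _ _ ltac:(lra) H1).
    pose proof (Rmult_lt_compat_l (1 - t) _ _ ltac:(lra) H6). lra. }
  intros x y t Hx Hy Hne Ht. destruct (Rlt_dec x y) as [H|H].
  - apply Hlt; lra.
  - pose proof (Hlt y x (1 - t) ltac:(lra) ltac:(lra) ltac:(lra) ltac:(lra)) as H'.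
    replace (1 - (1 - t)) with t in H' by ring.
    replace (t * x + (1 - t) * y) with ((1 - t) * y + t * x) by ring. lra.
Qed.

Lemma lim_at_0_lower (N : nat) (g : R -> R) (f0 lam1 lam : R) :
  (1 <= N)%nat -> 0 < f0 -> 0 < lam1 -> lam1 / f0 < lam -> lim_at_0 N g (f0 ^ N) ->
  exists K a0, lam1 ^ N < K /\ 0 < a0 /\
    forall s, 0 < s <= a0 -> K * s ^ N <= lam ^ N * g s.
Proof.
  intros HN Hf0 Hlam1 Hlam Hlim.
  assert (Hlf : lam1 < lam * f0) by (apply Rlt_div_l in Hlam; lra).
  assert (Hlam0 : 0 < lam) by nra.
  assert (HB : 0 < lam ^ N) by now apply pow_lt.
  assert (Hpow : lam1 ^ N < lam ^ N * f0 ^ N).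
  { rewrite <- Rpow_mult_distr. apply pow_lt_compat; trivial; lra. }
  (* This tolerance makes [K] the midpoint of [lam1 ^ N] and [lam ^ N * f0 ^ N]. *)
  set (eta := (lam ^ N * f0 ^ N - lam1 ^ N) / (2 * lam ^ N)).
  assert (Heta : 0 < eta) by (apply Rdiv_lt_0_compat; lra).
  destruct (Hlim eta Heta) as [d [Hd H]].
  exists (lam ^ N * (f0 ^ N - eta)), (d / 2).
  assert (E : lam ^ N * eta = (lam ^ N * f0 ^ N - lam1 ^ N) / 2)
    by (unfold eta; field; lra).
  split; [lra|]. split; [lra|]. intros s Hs.
  specialize (H s ltac:(lra)). rewrite (Rabs_pos_eq s) in H by lra.
  specialize (H ltac:(lra)). apply Rabs_def2 in H.
  assert (Hsn : 0 < s ^ N) by (apply pow_lt; lra).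
  rewrite Rmult_assoc. apply Rmult_le_compat_l; [lra|].
  replace (g s) with (g s / s ^ N * s ^ N) by (field; lra).
  apply Rmult_le_compat_r; lra.
Qed.

(** A polygon started at [A] drops by at most the [N]-th root of [M * B] on [[0,1]], so
    [M * B < A ^ N] keeps it positive. *)
Lemma lim_at_inf_upper (N : nat) (g : R -> R) (B a0 : R) :
  (1 <= N)%nat -> 0 < B -> continuity g -> lim_at_inf N g 0 ->
  exists A M, a0 <= A /\ 0 < A /\ 0 <= M /\ M * B < A ^ N /\
    forall s, 0 <= s <= A -> g s <= M.
Proof.
  intros HN HB Hg Hlim.
  set (e := / (2 * B)). assert (He : 0 < e) by (apply Rinv_0_lt_compat; lra).
  destruct (Hlim e He) as [m [Hm Hinf]].
  destruct (continuity_ab_maj g 0 m ltac:(lra) (fun c _ => Hg c)) as [x [Hx _]].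
  (* [A >= 1] gives [A <= A ^ N]; then [A >= g x / e] lets [M = e * A ^ N] dominate the maximum
     [g x] on [[0,m]] too, while [M * B = A ^ N / 2]. *)
  set (A := Rmax (Rmax a0 1) (g x / e)).
  assert (HA1 : 1 <= A) by (eapply Rle_trans; [apply Rmax_r|apply Rmax_l]).
  assert (HAN : A <= A ^ N).
  { rewrite <- (pow_1 A) at 1. apply Rle_pow; trivial. }
  assert (HeA : 0 < e * A ^ N) by (apply Rmult_lt_0_compat; lra).
  exists A, (e * A ^ N). repeat split; try lra.
  - eapply Rle_trans; [apply Rmax_l|apply Rmax_l].
  - replace (e * A ^ N * B) with (A ^ N / 2) by (unfold e; field; lra). lra.
  - intros s Hs. destruct (Rle_dec s m) as [Hsm|Hsm].
    + apply Rle_trans with (g x); [apply Hx; lra|].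
      assert (g x / e <= A) by apply Rmax_r.
      replace (g x) with (e * (g x / e)) by (field; lra).
      apply Rmult_le_compat_l; lra.
    + specialize (Hinf s). rewrite (Rabs_pos_eq s), Rminus_0_r in Hinf by lra.
      specialize (Hinf ltac:(lra)). apply Rabs_def2 in Hinf.
      assert (Hsn : 0 < s ^ N) by (apply pow_lt; lra).
      assert (s ^ N <= A ^ N) by (apply pow_incr; lra).
      replace (g s) with (g s / s ^ N * s ^ N) by (field; lra).
      apply Rle_trans with (e * s ^ N); [apply Rmult_le_compat_r; lra|].
      apply Rmult_le_compat_l; lra.
Qed.

(** The end value is positive when starting from [A]. If it is negative from [a0], the intermediate
    value theorem gives a start with end value 0; otherwise [a0] itself is taken. The last equation
    covers both cases. *)
Lemma euler_shooting (N : nat) (B A M a0 : R) (G : R -> R) (i : nat) :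
  (1 <= N)%nat -> 0 < B -> continuity G -> (forall s, 0 <= G s) ->
  a0 <= A -> 0 < A -> 0 <= M -> M * B < A ^ N -> (forall s, s <= A -> G s <= M) ->
  exists a, a0 <= a <= A /\ 0 <= ev N B (mesh i) G a (S i) /\
    ev N B (mesh i) G a (S i) * (a - a0) = 0.
Proof.
  intros HN HB HGc HG HaA HA HM HMA HGM.
  set (E := fun a => ev N B (mesh i) G a (S i)).
  assert (Hm1 : INR (S i) * mesh i = 1).
  { unfold mesh. apply Rinv_r. apply not_0_INR. lia. }
  assert (HEA : 0 < E A).
  { destruct (ev_bound N B (mesh i) G HN HB (mesh_pos i) HG A M (S i) HGM) as [H _].
    rewrite Hm1, pow1, Rmult_1_l, Rmult_1_r in H.
    assert (Hr : nroot N (M * B) < A).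
    { rewrite <- (nroot_of_pow N A) by (trivial; lra). apply nroot_lt; trivial.
      split; [apply Rmult_le_pos; lra|trivial]. }
    unfold E. lra. }
  destruct (Rle_dec 0 (E a0)) as [H0|H0].
  - exists a0. split; [lra|]. split; [exact H0|]. now rewrite Rminus_diag, Rmult_0_r.
  - destruct (IVT_cor E a0 A) as [z [Hz Ez]].
    + apply euler_continuity; trivial.
    + trivial.
    + nra.
    + exists z. unfold E in Ez. rewrite Ez. repeat split; lra.
Qed.

(** The sign condition speaks only of nonzero arguments; at 0 the value is a limit of positive
    ones. *)
Lemma nonneg_at_0 (g : R -> R) :
  continuity g -> (forall s, 0 < s -> 0 < g s) -> 0 <= g 0.
Proof.
  intros Hg Hpos. apply Rnot_lt_le. intros Hlt.
  destruct (Hg 0 (- g 0) ltac:(lra)) as [d [Hd H]].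
  assert (Hd' : Rabs (d / 2 - 0) < d) by (rewrite Rminus_0_r, Rabs_pos_eq; lra).
  assert (Hne : 0 <> d / 2) by lra.
  specialize (H (d / 2) (conj (conj I Hne) Hd')). simpl in H. unfold R_dist in H.
  apply Rabs_def2 in H. specialize (Hpos (d / 2) ltac:(lra)). lra.
Qed.

(** [Y] stands for [-v'], which keeps the flux [Y ^ N] nonnegative for every parity of [N]; signs
    are restored only in the final theorem. *)
Lemma positive_solution (N : nat) (g : R -> R) (f0 lam1 lam : R) :
  (1 <= N)%nat -> cond_f1 N g -> 0 < f0 -> lim_at_0 N g (f0 ^ N) -> lim_at_inf N g 0 ->
  is_first_eigenvalue N lam1 -> lam1 / f0 < lam ->
  exists v Y Y', C2_01 v (fun r => - Y r) (fun r => - Y' r) /\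
    (forall r, 0 < r < 1 -> derivable_pt_lim (fun s => Y s ^ N) r
       (lam ^ N * INR N * r ^ (N - 1) * g (v r))) /\
    Y 0 = 0 /\ v 1 = 0 /\ pos_01 v /\ strictly_concave_01 v.
Proof.
  intros HN [Hgc Hgs] Hf0 Hlim0 Hliminf [Hlam1 [[phi [Hphi Hphipos]] _]] Hlam.
  assert (Hlam0 : 0 < lam).
  { apply Rlt_trans with (lam1 / f0); [now apply Rdiv_lt_0_compat|trivial]. }
  set (B := lam ^ N). assert (HB : 0 < B) by now apply pow_lt.
  assert (Hgpos : forall s, 0 < s -> 0 < g s).
  { intros s Hs. specialize (Hgs s ltac:(lra)). pose proof (pow_lt s N Hs). nra. }
  assert (Hg0 := nonneg_at_0 g Hgc Hgpos).
  destruct (lim_at_0_lower N g f0 lam1 lam HN Hf0 Hlam1 Hlam Hlim0)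
    as [K [a0 [HK [Ha0 HKg]]]].
  destruct (lim_at_inf_upper N g B a0 HN HB Hgc Hliminf)
    as [A [M [HaA [HA [HM [HMA HgM]]]]]].
  (* Polygons may fall below 0, so [g] is continued there by the constant [g 0], which keeps it
     continuous, nonnegative and bounded on each half-line below. *)
  set (G := fun s => g (Rmax 0 s)).
  assert (HG : forall s, 0 <= G s).
  { intros s. unfold G. destruct (Rle_lt_or_eq_dec 0 (Rmax 0 s) (Rmax_l 0 s)) as [H|H].
    - left. now apply Hgpos.
    - now rewrite <- H. }
  assert (HGg : forall s, 0 <= s -> G s = g s).
  { intros s Hs. unfold G. now rewrite Rmax_right. }
  assert (HGc : continuity G).
  { intros s eps Heps. destruct (Hgc (Rmax 0 s) eps Heps) as [d [Hd H]].
    exists d. split; [trivial|]. intros y [_ Hy]. unfold G.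
    simpl in *. unfold R_dist in *.
    destruct (Req_dec (Rmax 0 s) (Rmax 0 y)) as [E|Hne].
    - rewrite <- E. unfold Rminus. now rewrite Rplus_opp_r, Rabs_R0.
    - apply H. split; [split; [exact I|trivial]|].
      eapply Rle_lt_trans; [|exact Hy]. unfold Rmax.
      repeat destruct (Rle_dec _ _); unfold Rabs; repeat destruct (Rcase_abs _); lra. }
  assert (HGM : forall s, s <= A -> G s <= M).
  { intros s Hs. apply HgM. split; [apply Rmax_l|]. apply Rmax_lub; lra. }
  assert (Hsh := fun i => euler_shooting N B A M a0 G i HN HB HGc HG HaA HA HM HMA HGM).
  set (a := fun i => proj1_sig (constructive_indefinite_description _ (Hsh i))).
  assert (Ha := fun i => proj2_sig (constructive_indefinite_description _ (Hsh i))).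
  fold a in Ha.
  destruct (euler_limit N B A M a0 G a HN HB HG HGM) as
    [v [w [Hw0 [Hv0 [Hv1 [Hv01 [Hslope Hinc]]]]]]];
    [intros i; apply Ha|intros i; apply Ha|intros i; apply Ha|].
  assert (Hlow := slope_linear_lower v (fun r => nroot N (w r)) Hslope Hv1).
  assert (Hvpos : forall r, 0 <= r < 1 -> 0 < v r).
  { intros r Hr. specialize (Hlow r ltac:(lra)).
    assert (0 < v 0 * (1 - r)) by (apply Rmult_lt_0_compat; lra). lra. }
  assert (HGv0 : 0 < G (v 0)) by (rewrite HGg by lra; apply Hgpos; lra).
  assert (Hwc : cont_01 w).
  { apply continuity_cont_01 with (fun r => w (Rabs r)).
    - apply (flux_continuity N B G v w); trivial.
    - intros r Hr. now rewrite Rabs_pos_eq. }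
  assert (Hwd := flux_derivable N B G v w HN HB HGc HG Hslope Hinc).
  assert (Hv1' : v 1 = 0).
  (* If instead [v 0 = a0], then [v] takes values in [(0,a0]] on [(0,1)], where
     [lam ^ N * g s >= K * s ^ N]; hence [v] is an excluded supersolution. *)
  { destruct (Rmult_integral _ _ Hv01) as [H|H]; [trivial|exfalso].
    refine (no_positive_supersolution N lam1 K phi v (fun r => nroot N (w r)) w
      (fun r => B * INR N * r ^ (N - 1) * G (v r)) HN Hlam1 HK Hphi Hphipos
      _ (fun r => nroot_ge0 N (w r)) Hwc Hw0 _ _ _ Hv1 (v 0) _ Hlow).
    - apply (sol_has_deriv N B G v w); trivial.
    - intros r Hr. symmetry. apply nroot_pow; trivial.
      apply (flux_ge0 N B G v w); trivial; lra.
    - intros r Hr. apply Hwd; lra.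
    - intros r Hr. assert (Hvr := Hvpos r ltac:(lra)). rewrite HGg by lra.
      assert (Hvr0 := sol_antitone N v w Hslope 0 r ltac:(lra)).
      assert (HKr := HKg (v r) ltac:(lra)). fold B in HKr.
      assert (Hr0 : 0 <= INR N * r ^ (N - 1))
        by (apply Rmult_le_pos; [apply pos_INR|apply pow_le; lra]).
      pose proof (Rmult_le_compat_l _ _ _ Hr0 HKr). lra.
    - lra. }
  exists v, (fun r => nroot N (w r)), (sol_second N B G v w).
  split; [|split; [|split; [|split; [|split]]]]; trivial.
  - apply sol_C2; trivial.
  - intros r Hr. rewrite <- HGg by (left; apply Hvpos; lra).
    apply root_flux_pow_derivable; trivial; lra.
  - rewrite Hw0. apply nroot_0.
  - intros r Hr. apply Hvpos. lra.
  - apply (slope_strictly_concave v (fun r => nroot N (w r))); trivial.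
    intros s r Hsr Hr. apply nroot_lt; trivial.
    split; [apply (flux_ge0 N B G v w); trivial; lra|].
    (* Strict concavity needs a strictly increasing flux; its derivative is positive because [v] is
       positive before 1. *)
    destruct (MVT_01 w (fun r => B * INR N * r ^ (N - 1) * G (v r)) s r) as [c [Hc E]];
      trivial; try lra.
    + intros x Hx. apply Hwd. lra.
    + assert (0 < B * INR N * c ^ (N - 1) * G (v c) * (r - s)); [|lra].
      rewrite HGg by (left; apply Hvpos; lra).
      repeat apply Rmult_lt_0_compat; trivial.
      * apply lt_0_INR. lia.
      * apply pow_lt. lra.
      * apply Hgpos, Hvpos. lra.
      * lra.
Qed.

(** * Reflection and the two solutions *)

Lemma C2_01_opp (u u1 u2 : R -> R) :
  C2_01 u (fun r => - u1 r) (fun r => - u2 r) -> C2_01 (fun r => - u r) u1 u2.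
Proof.
  intros [H1 [H2 H3]].
  assert (Hd1 := has_deriv_01_opp _ _ H1). assert (Hd2 := has_deriv_01_opp _ _ H2).
  split; [|split].
  - intros r Hr eps Heps. destruct (Hd1 r Hr eps Heps) as [d [Hd H]].
    exists d. split; [trivial|]. intros y Hy Hne Hyd. specialize (H y Hy Hne Hyd).
    now rewrite Ropp_involutive in H.
  - intros r Hr eps Heps. destruct (Hd2 r Hr eps Heps) as [d [Hd H]].
    exists d. split; [trivial|]. intros y Hy Hne Hyd. specialize (H y Hy Hne Hyd).
    now rewrite !Ropp_involutive in H.
  - intros r Hr eps Heps. destruct (H3 r Hr eps Heps) as [d [Hd H]].
    exists d. split; [trivial|]. intros y Hy Hyd. specialize (H y Hy Hyd).
    replace (u2 y - u2 r) with (- (- u2 y - - u2 r)) by ring. now rewrite Rabs_Ropp.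
Qed.

Lemma pow_opp (N : nat) (x : R) : (- x) ^ N = (-1) ^ N * x ^ N.
Proof. rewrite <- Rpow_mult_distr. f_equal. ring. Qed.

Lemma pow_neg1_sqr (N : nat) : (-1) ^ N * (-1) ^ N = 1.
Proof. rewrite <- Rpow_mult_distr. replace (-1 * -1) with 1 by ring. apply pow1. Qed.

(** As [(-1) ^ N] is its own inverse, the reflected nonlinearity has at [s] the quotient of [f] at
    [- s], hence the same limits at 0 and at infinity. *)
Lemma reflect_div_pow (N : nat) (f : R -> R) (s : R) :
  (-1) ^ N * f (- s) / s ^ N = f (- s) / (- s) ^ N.
Proof.
  rewrite pow_opp. unfold Rdiv. rewrite Rinv_mult.
  replace (/ (-1) ^ N) with ((-1) ^ N); [ring|].
  apply Rmult_eq_reg_l with ((-1) ^ N); [|apply pow_nonzero; lra].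
  rewrite pow_neg1_sqr, Rinv_r; [trivial|apply pow_nonzero; lra].
Qed.

Theorem theorem4p2 (N : nat) (f : R -> R) (f0 lam1 : R) :
  (1 <= N)%nat ->
  cond_f1 N f ->
  0 < f0 -> lim_at_0 N f (f0 ^ N) ->
  lim_at_inf N f 0 ->
  is_first_eigenvalue N lam1 ->
  forall lam, lam1 / f0 < lam ->
    exists up um,
      MO_sol N f lam up /\ pos_01 up /\ strictly_concave_01 up /\
      MO_sol N f lam um /\ neg_01 um /\ strictly_convex_01 um.
Proof.
  intros HN [Hfc Hfs] Hf0 Hlim0 Hliminf Hlam1 lam Hlam.
  assert (Hm := pow_neg1_sqr N).
  (* The positive solution [u] has [u' = -Y], so [(u')^N] is [(-1)^N Y^N], and this sign cancels the
     one in the reflected nonlinearity. *)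
  destruct (positive_solution N (fun s => (-1) ^ N * f (- s)) f0 lam1 lam)
    as [u [Y [Y' [HC2 [HD [HY0 [Hu1 [Hpos Hconc]]]]]]]]; trivial.
  { split.
    - intros s. apply continuity_pt_scal.
      apply (continuity_pt_comp Ropp f); [|apply Hfc].
      apply continuity_pt_opp, derivable_continuous_pt, derivable_pt_id.
    - intros s Hs. specialize (Hfs (- s) ltac:(lra)). rewrite pow_opp in Hfs. lra. }
  { intros eps Heps. destruct (Hlim0 eps Heps) as [d [Hd H]]. exists d. split; [trivial|].
    intros s Hs Hsd. rewrite reflect_div_pow. apply H; [lra|]. now rewrite Rabs_Ropp. }
  { intros eps Heps. destruct (Hliminf eps Heps) as [m [Hm0 H]]. exists m. split; [trivial|].
    intros s Hs. rewrite reflect_div_pow. apply H. now rewrite Rabs_Ropp. }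
  (* The negative solution is [-v], with derivative [Z]; the argument of [f] in the equation is then
     [v] itself. *)
  destruct (positive_solution N f f0 lam1 lam)
    as [v [Z [Z' [HC2' [HD' [HZ0 [Hv1 [Hpos' Hconc']]]]]]]]; trivial; [now split|].
  exists u, (fun r => - v r). split; [|split; [|split; [|split; [|split]]]]; trivial.
  - exists (fun r => - Y r), (fun r => - Y' r). split; [trivial|]. split; [|split; [lra|trivial]].
    intros r Hr.
    replace (lam ^ N * INR N * r ^ (N - 1) * f (- u r)) with
      ((-1) ^ N * (lam ^ N * INR N * r ^ (N - 1) * ((-1) ^ N * f (- u r)))).
    + apply is_derive_Reals. apply is_derive_ext with (fun s => (-1) ^ N * Y s ^ N).
      * intros s. symmetry. apply pow_opp.
      * apply is_derive_Reals. apply derivable_pt_lim_scal. now apply HD.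
    + transitivity ((-1) ^ N * (-1) ^ N * (lam ^ N * INR N * r ^ (N - 1) * f (- u r)));
        [ring|]. rewrite Hm. ring.
  - exists Z, Z'. split; [now apply C2_01_opp|]. split; [|split; [trivial|lra]].
    intros r Hr. rewrite Ropp_involutive. now apply HD'.
  - intros r Hr. specialize (Hpos' r Hr). lra.
  - intros x y t Hx Hy Hne Ht. specialize (Hconc' x y t Hx Hy Hne Ht). lra.
Qed.
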